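(* Let $L,N,M$ be integers and $0<\alpha<1$ with $L-N\ge1$, $M\ge1$, $N-2M\ge1$. Let the initial distribution of $v^0$ be an arbitrary probability measure supported on $\{x\in\{0,1\}^L:\#1(x)=N,\ \#110(x)=M\}$. Then the mean flux $Q$ of the stochastic system $(v^n)$ described in the context (a limit, which exists) is independent of the initial distribution and is given by $$Q=\frac1L\;\frac{\displaystyle\sum_{k_1,k_2\ge0}(\alpha k_1+k_2)\frac{\alpha^{k_2}}{(1-\alpha)^{k_1+k_2}}\,\mathcal N(k_1,k_2)}{\displaystyle\sum_{k_1,k_2\ge0}\frac{\alpha^{k_2}}{(1-\alpha)^{k_1+k_2}}\,\mathcal N(k_1,k_2)},$$ where, with $R(k_2):=N-2M-k_2$, $$\mathcal N(k_1,k_2)=\begin{cases}\binom{L-N-M}{k_2}\binom{M}{k_1}\binom{R(k_2)-1}{k_1-1}&(1\le k_1\le R(k_2)),\\ \binom{L-N-M}{k_2}&(k_1=0,\ R(k_2)=0),\\ 0&\text{(otherwise)}.\end{cases}$$ Consequently, with $\rho_1=N/L$ and $\rho_{110}=M/L$, the mean flux $Q_u=\rho_1-Q$ of the original system $(u^n)$ described in the context is (for given $L$ and $\alpha$) uniquely determined by the pair of conserved densities $(\rho_1,\rho_{110})$. Moreover, with $L,N,M$ fixed, $$\lim_{\alpha\to1}Q_u=\max(2\rho_1-1,\,2\rho_{110}).$$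
   Context: Configurations are $x=(x_j)_{j=1}^L\in\{0,1\}^L$ with site indices taken modulo $L$. For a word $a_1\cdots a_k$, $\#a_1\cdots a_k(x)$ is the number of sites $j\in\{1,\dots,L\}$ with $x_jx_{j+1}\cdots x_{j+k-1}=a_1\cdots a_k$ (indices mod $L$). Convention: $\binom ab=0$ if $b<0$ or $b>a$. System $(v^n)$: $v_j^{n+1}=v_j^n+q_{j-1}^n-q_j^n$, where $q_j^n=q(v_{j-2}^n,v_{j-1}^n,v_j^n,v_{j+1}^n)$, with $q(0,0,1,0)=q(1,0,1,0)=1$, $q(1,1,1,0)=b$, and $q=0$ for all other arguments. Here $b=b_j^n$ equals $1$ with probability $\alpha$ and $0$ with probability $1-\alpha$, independently for different sites and times and of the initial configuration (the same realized value $q_j^n$ is used in the updates of sites $j$ and $j+1$). This is a Markov chain on $\{0,1\}^L$ that conserves $\#1$ and $\#110$. Its mean flux is $$Q=\lim_{n\to\infty}\frac1L\sum_{j=1}^L E\big[q(v_{j-2}^n,v_{j-1}^n,v_j^n,v_{j+1}^n)\big],$$ which equals $\lim_{n\to\infty}\frac1L E[\alpha\,\#1110(v^n)+\#010(v^n)]$. Original system $(u^n)$: $u_j^{n+1}=u_j^n+q_1(u_{j-2}^n,u_{j-1}^n,u_j^n,u_{j+1}^n)-q_1(u_{j-1}^n,u_j^n,u_{j+1}^n,u_{j+2}^n)$, where $q_1(w,x,y,z)=1$ for $(w,x,y,z)\in\{1111,1110,1101,1100,0110\}$, $q_1(0,1,1,1)=a$ with $a=1-b$ (so $a=0$ with probability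 $\alpha$ and $a=1$ with probability $1-\alpha$, independently over sites and times), and $q_1=0$ for all other arguments. The two systems are related by $v_j^n=u_{n-j}^n$ (in particular $u^0_{-j}=v^0_j$). The mean flux $Q_u$ of $(u^n)$ is $\lim_{n\to\infty}\frac1L\sum_j E[q_1(u_{j-2}^n,u_{j-1}^n,u_j^n,u_{j+1}^n)]$, and $Q_u=\rho_1-Q$ under this correspondence. *)

(* Defs.v *)
From mathcomp Require Import all_boot all_order all_algebra.
From mathcomp Require Import zify.
From mathcomp Require Import all_classical all_reals all_analysis.
Import Order.TTheory GRing.Theory Num.Theory.
Import numFieldNormedType.Exports.

Set Implicit Arguments.
Unset Strict Implicit.
Unset Printing Implicit Defensive.

Local Open Scope classical_set_scope.
Local Open Scope ring_scope.

(* The sites are 'I_L, read as the cycle Z/LZ: the neighbours j + 1 and j - 1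
   of a site j are [ordS j] and [ord_pred j]. *)
Definition config (L : nat) := {ffun 'I_L -> bool}.

Definition word_at (L : nat) (x : config L) (k : nat) (j : 'I_L) : seq bool :=
  [seq x (iter i (@ordS L) j) | i <- iota 0 k].

Definition word_count (L : nat) (a : seq bool) (x : config L) : nat :=
  #|[pred j : 'I_L | word_at x (size a) j == a]|.

Definition has_counts (L N M : nat) (x : config L) : Prop :=
  word_count [:: true] x = N /\ word_count [:: true; true; false] x = M.

Definition q_rule (b w x y z : bool) : bool :=
  match w, x, y, z with
  | false, false, true, false => true
  | true, false, true, false => true
  | true, true, true, false => b
  | _, _, _, _ => false
  end.

Definition q1_rule (a w x y z : bool) : bool :=
  match w, x, y, z with
  | true, true, true, true => true
  | true, true, true, false => true
  | true, true, false, true => true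
  | true, true, false, false => true
  | false, true, true, false => true
  | false, true, true, true => a
  | _, _, _, _ => false
  end.

(* Value of a rule on the window (x_{j-2}, x_{j-1}, x_j, x_{j+1}), with the
   random bit c_j attached to the site j. *)
Definition local_flux (L : nat) (rule : bool -> bool -> bool -> bool -> bool -> bool)
    (c : 'I_L -> bool) (x : config L) (j : 'I_L) : bool :=
  rule (c j) (x (ord_pred (ord_pred j))) (x (ord_pred j)) (x j) (x (ordS j)).

Section Probability.
Context {d : measure_display} {T : measurableType d} {R : realType}.
Variable P : probability T R.

(* Events determined by X, for X valued in a set with the discrete
   sigma-algebra. *)
Definition events_of (S : Type) (X : T -> S) : set (set T) :=
  [set X @^-1` B | B in [set: set S]].

Definition discrete_rv (S : Type) (X : T -> S) : Prop :=
  events_of X `<=` measurable.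

Definition mutually_independent (I : choiceType) (F : I -> set (set T)) : Prop :=
  forall (J : seq I) (A : I -> set T), uniq J ->
    (forall i, i \in J -> F i (A i)) ->
    P (\bigcap_(i in [set` J]) A i) = (\prod_(i <- J) P (A i))%E.

(* The bits c_j^n are Bernoulli(p), mutually independent over all times n and
   sites j, and independent of the random configuration x0 (index [None]). *)
Definition bernoulli_noise (L : nat) (p : R) (x0 : T -> config L)
    (c : nat -> 'I_L -> T -> bool) : Prop :=
  [/\ discrete_rv x0,
      forall n j, discrete_rv (c n j),
      forall n j, P [set w | c n j w] = p%:E
    & mutually_independent (fun i : option (nat * 'I_L) =>
        match i with
        | None => events_of x0
        | Some (n, j) => events_of (c n j)
        end)].

(* The update equations are equations between integers. *)
Definition v_system (L : nat) (alpha : R) (b : nat -> 'I_L -> T -> bool)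
    (v : nat -> T -> config L) : Prop :=
  bernoulli_noise alpha (v 0%N) b /\
  forall n w j,
    let q_ i := local_flux q_rule (fun k => b n k w) (v n w) i in
    (v n.+1 w j)%:Z = (v n w j)%:Z + (q_ (ord_pred j))%:Z - (q_ j)%:Z.

(* a = 1 - b takes the value 1 with probability 1 - alpha; the bit a_j^n is
   attached to the window (u_{j-2}, u_{j-1}, u_j, u_{j+1}). *)
Definition u_system (L : nat) (alpha : R) (a : nat -> 'I_L -> T -> bool)
    (u : nat -> T -> config L) : Prop :=
  bernoulli_noise (1 - alpha) (u 0%N) a /\
  forall n w j,
    let q_ i := local_flux q1_rule (fun k => a n k w) (u n w) i in
    (u n.+1 w j)%:Z = (u n w j)%:Z + (q_ j)%:Z - (q_ (ordS j))%:Z.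

Definition supported_on_counts (L N M : nat) (x0 : T -> config L) : Prop :=
  P [set w | has_counts N M (x0 w)] = 1%:E.

Definition flux_at (L : nat) (rule : bool -> bool -> bool -> bool -> bool -> bool)
    (c : nat -> 'I_L -> T -> bool) (x : nat -> T -> config L) (n : nat) : R :=
  L%:R^-1 * \sum_(j < L)
    fine ('E_P[(fun w => (local_flux rule (fun k => c n k w) (x n w) j)%:R : R)])%E.

Definition has_mean_flux (L : nat)
    (rule : bool -> bool -> bool -> bool -> bool -> bool)
    (c : nat -> 'I_L -> T -> bool) (x : nat -> T -> config L) (Q : R) : Prop :=
  flux_at rule c x @ \oo --> Q.

End Probability.

Definition binz (a b : int) : nat :=
  if (0 <= b) && (b <= a) then 'C(`|a|, `|b|) else 0%N.

Definition weight_count (L N M k1 k2 : nat) : nat :=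
  let r : int := N%:Z - 2 * M%:Z - k2%:Z in
  let c : nat := binz (L%:Z - N%:Z - M%:Z) k2%:Z in
  if (1 <= k1%:Z) && (k1%:Z <= r)
  then (c * binz M%:Z k1%:Z * binz (r - 1) (k1%:Z - 1))%N
  else if (k1 == 0%N) && (r == 0) then c else 0%N.

(* [weight_count] vanishes outside 0 <= k1, k2 <= N, so the sums over all
   k1, k2 >= 0 may be truncated there. *)
Lemma weight_count_eq0 (L N M k1 k2 : nat) :
  (N < k1)%N || (N < k2)%N -> weight_count L N M k1 k2 = 0%N.
Proof.
rewrite /weight_count => h; case: ifP => [|_]; last case: ifP => //; lia.
Qed.

Definition flux_formula (R : realType) (L N M : nat) (alpha : R) : R :=
  let W (k1 k2 : nat) : R :=
    alpha ^+ k2 / (1 - alpha) ^+ (k1 + k2) * (weight_count L N M k1 k2)%:R in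
  L%:R^-1 *
  ((\sum_(0 <= k1 < N.+1) \sum_(0 <= k2 < N.+1) (alpha * k1%:R + k2%:R) * W k1 k2)
   / (\sum_(0 <= k1 < N.+1) \sum_(0 <= k2 < N.+1) W k1 k2)).

Definition admissible (L N M : nat) : Prop :=
  [/\ (N < L)%N, (0 < M)%N & (2 * M < N)%N].

(* Main.v *)
(* Label the zeros of v^n cyclically and let n_i be the number of ones between
   the i-th zero and the next one. In these variables the dynamics is a zero
   range process with parallel update on K = L - N sites: a site with one
   particle always releases it to the next site, a site with at least three
   particles releases one with probability alpha, and the other sites release
   nothing. The set of sites with n_i >= 2 never changes and has M elements.
   Giving weight beta^|J|, beta = alpha / (1 - alpha), to a state together with
   an allowed set J of jumps, the step (state, J) -> (new state, J shifted) is a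
   bijection of the allowed pairs, so the weight obtained by summing over J,
   alpha^k2 / (1 - alpha)^(k1 + k2) with k1 = #1110 and k2 = #010, is stationary.
   If exactly one of the M sites is kept from releasing, all mobile particles
   end up there, so a fixed noise pattern brings all states together; hence the
   chain forgets its initial state and the flux converges to the stationary
   mean, computed by counting the states with given k1 and k2.
   The u-system is the mirror image of the v-system: q1(w,x,y,z) = x - q(z,y,x,w).
   As alpha -> 1 only the largest value min(L - N, N - 2M) of k1 + k2 survives. *)
Require Import Defs.
From HB Require Import structures.
From mathcomp Require Import all_boot all_order all_algebra.
From mathcomp Require Import zify ring lra.
From mathcomp Require Import all_classical all_reals all_analysis.
Import Order.TTheory GRing.Theory Num.Theory.
Import numFieldNormedType.Exports.

Set Implicit Arguments.
Unset Strict Implicit.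
Unset Printing Implicit Defensive.

Local Open Scope ring_scope.

(** * Ergodic theorem for a finite chain driven by i.i.d. noise that has a synchronizing value *)

Section Transfer.
Local Open Scope classical_set_scope.
Context {R : realType} {S C : finType}.
Variables (pi : C -> R) (step : S -> C -> S).

(** The Markov operator on observables: its n-th iterate on [g] is the expectation of [g] at time n
    as a function of the starting state. *)
Definition transfer (g : S -> R) (s : S) : R := \sum_c pi c * g (step s c).

Lemma transfer_sum (I : finType) (h : I -> S -> R) n s :
  iter n transfer (fun s => \sum_i h i s) s = \sum_i iter n transfer (h i) s.
Proof.
elim: n s => //= n IHn s; rewrite /transfer exchange_big /=.
by apply: eq_bigr => c _; rewrite IHn mulr_sumr.
Qed.

Hypothesis pi_ge0 : forall c, 0 <= pi c.
Hypothesis pi_sum1 : \sum_c pi c = 1.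
Variable D : {pred S}.
Hypothesis stepD : forall s c, s \in D -> step s c \in D.

Lemma iter_stepD n c s : s \in D -> iter n (step^~ c) s \in D.
Proof. by move=> sD; elim: n => //= n; apply: stepD. Qed.

Lemma transfer_bounds lo hi (g : S -> R) :
  {in D, forall s, lo <= g s <= hi} ->
  {in D, forall s, lo <= transfer g s <= hi}.
Proof.
move=> gb s sD; rewrite -[lo]mul1r -[hi]mul1r -pi_sum1 !mulr_suml.
by apply/andP; split; apply: ler_sum => c _; apply: ler_wpM2l => //;
   case/andP: (gb _ (stepD c sD)).
Qed.

Lemma iter_transfer_bounds lo hi n (g : S -> R) :
  {in D, forall s, lo <= g s <= hi} ->
  {in D, forall s, lo <= iter n transfer g s <= hi}.
Proof. by move=> gb; elim: n => //= n; apply: transfer_bounds. Qed.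

Variables (c0 : C) (n0 : nat) (s0 : S).
Hypothesis pi_c0 : 0 < pi c0.
Hypothesis coalesce : {in D, forall s, iter n0 (step^~ c0) s = s0}.
Let eps := pi c0 ^+ n0.

(** Only the path along which the noise equals [c0] at all n times is kept; the other paths
    contribute nonnegative terms. *)
Lemma transfer_lower (g : S -> R) n :
  {in D, forall s, 0 <= g s} ->
  {in D, forall s, pi c0 ^+ n * g (iter n (step^~ c0) s) <= iter n transfer g s}.
Proof.
move=> g0; elim: n => [|n IHn] s sD; first by rewrite expr0 mul1r.
have tn0 c : 0 <= iter n transfer g (step s c).
  apply: le_trans (IHn _ (stepD c sD)).
  by apply: mulr_ge0; [exact: exprn_ge0 | exact/g0/iter_stepD/stepD].
rewrite iterSr [leRHS]/= /transfer (bigD1 c0) //= exprS -mulrA.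
rewrite -[leLHS]addr0; apply: lerD.
  by apply: ler_wpM2l => //; apply/IHn/stepD.
by apply: sumr_ge0 => c _; apply: mulr_ge0.
Qed.

Lemma transfer_affine (g : S -> R) (u v : R) n s :
  iter n transfer (fun s => u * g s + v) s = u * iter n transfer g s + v.
Proof.
elim: n s => //= n IHn s; rewrite /transfer mulr_sumr -[X in _ = _ + X]mul1r.
rewrite -pi_sum1 mulr_suml -big_split /=.
by apply: eq_bigr => c _; rewrite IHn; ring.
Qed.

(** Doeblin's argument: from every state of [D] the chain is at [s0] after [n0] steps with
    probability at least [eps]. Applying [transfer_lower] to [g - lo] and to [hi - g] moves both
    ends of the interval toward [g s0] by the fraction [eps] of their distance to it. *)
Lemma transfer_contract lo hi (g : S -> R) :
  {in D, forall s, lo <= g s <= hi} ->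
  exists lo' hi', hi' - lo' = (1 - eps) * (hi - lo) /\
    {in D, forall s, lo' <= iter n0 transfer g s <= hi'}.
Proof.
move=> gb; exists (lo + eps * (g s0 - lo)), (hi - eps * (hi - g s0)).
split; first by ring.
move=> s sD; apply/andP; split.
  have h : {in D, forall s, 0 <= 1 * g s + - lo}.
    by move=> t /gb /andP[? _]; rewrite mul1r subr_ge0.
  have := transfer_lower n0 h sD.
  by rewrite (transfer_affine g 1 (- lo)) coalesce // -/eps; lra.
have h : {in D, forall s, 0 <= -1 * g s + hi}.
  by move=> t /gb /andP[_ ?]; rewrite mulN1r addrC subr_ge0.
have := transfer_lower n0 h sD.
by rewrite (transfer_affine g (-1) hi) coalesce // -/eps; lra.
Qed.

Lemma transfer_contract_iter k lo hi (g : S -> R) :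
  {in D, forall s, lo <= g s <= hi} ->
  exists lo' hi', hi' - lo' = (1 - eps) ^+ k * (hi - lo) /\
    forall n, (k * n0 <= n)%N -> {in D, forall s, lo' <= iter n transfer g s <= hi'}.
Proof.
elim: k => [|k IHk] in g lo hi *.
  move=> gb; exists lo, hi; rewrite expr0 mul1r; split=> // n _.
  exact: iter_transfer_bounds.
move=> /transfer_contract[lo1 [hi1 [e1 /IHk[lo2 [hi2 [e2 b2]]]]]].
exists lo2, hi2; split; first by rewrite e2 e1 exprSr mulrA.
move=> n kn s sD.
have -> : n = ((n - n0) + n0)%N by nia.
by rewrite iterD; apply: b2 => //; nia.
Qed.

Variable w : S -> R.
Hypothesis w_gt0 : {in D, forall s, 0 < w s}.
Hypothesis w_stationary : forall g : S -> R,
  \sum_(s in D) w s * transfer g s = \sum_(s in D) w s * g s.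

(** Stationarity gives every iterate the same [w]-mean [m], so [m] lies in every interval that
    contains the values of an iterate on [D]. These intervals shrink geometrically, which forces all
    values to [m]. *)
Lemma transfer_cvg (f : S -> R) (s : S) : s \in D ->
  iter n transfer f s @[n --> \oo] -->
    (\sum_(t in D) w t * f t) / (\sum_(t in D) w t).
Proof.
move=> sD; set W := \sum_(t in D) w t; set m := _ / W.
have W_gt0 : 0 < W.
  rewrite /W (bigD1 s) //=; apply: ltr_wpDr; last exact: w_gt0.
  by apply: sumr_ge0 => t /andP[tD _]; exact/ltW/w_gt0.
have mean n : \sum_(t in D) w t * iter n transfer f t = m * W.
  rewrite /m divfK ?gt_eqF //.
  by elim: n => //= n IHn; rewrite w_stationary.
pose B : R := \sum_t `|f t|.
have fB : {in D, forall t, - B <= f t <= B}.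
  move=> t _; rewrite -ler_norml /B (bigD1 t) //= lerDl.
  by apply: sumr_ge0.
have in_itv lo hi n : {in D, forall t, lo <= iter n transfer f t <= hi} ->
    lo <= m <= hi.
  move=> b; rewrite -(ler_pM2r W_gt0) -[m <= hi](ler_pM2r W_gt0) -(mean n) /W !mulr_sumr.
  by apply/andP; split; apply: ler_sum => t tD; rewrite [_ * w t]mulrC ler_pM2l ?w_gt0 //;
    case/andP: (b t tD).
have pi_le1 : pi c0 <= 1.
  by rewrite -pi_sum1 (bigD1 c0) //= lerDl sumr_ge0.
have eps_gt0 : 0 < eps by apply: exprn_gt0.
have eps_le1 : eps <= 1 by apply: exprn_ile1 => //; exact: ltW.
have cvg0 : (1 - eps) ^+ k * (B - - B) @[k --> \oo] --> (0 : R).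
  rewrite -[X in _ --> X](mul0r (B - - B)); apply: cvgM; last exact: cvg_cst.
  by apply: cvg_expr; rewrite ger0_norm; lra.
apply/cvgrPdist_lt => e e0.
have /cvgrPdist_lt/(_ e e0)[k _ /(_ k (leqnn k)) /=] := cvg0.
rewrite sub0r normrN => ke.
have [lo [hi [lohi b]]] := transfer_contract_iter k fB.
near=> n.
have kn : (k * n0 <= n)%N by near: n; exact: nbhs_infty_ge.
have /andP[m1 m2] := in_itv _ _ _ (b n kn).
have /andP[f1 f2] := b n kn s sD.
apply: le_lt_trans (le_lt_trans (ler_norm _) ke); rewrite -lohi ler_norml.
by apply/andP; split; lra.
Unshelve. all: by end_near. Qed.

End Transfer.

(** * Finite families of independent Bernoulli bits *)

Section Bits.
Context {R : realType}.
Implicit Types (p : R) (I J : finType).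

Definition bern p (b : bool) : R := if b then p else 1 - p.

Definition bits_prob p I (c : {ffun I -> bool}) : R := \prod_i bern p (c i).

Lemma bern_sum p : \sum_b bern p b = 1.
Proof. by rewrite big_bool /bern /= addrC subrK. Qed.

Lemma bits_prob_gt0 p I (c : {ffun I -> bool}) : 0 < p < 1 -> 0 < bits_prob p c.
Proof.
by move=> hp; apply: prodr_gt0 => i _; rewrite /bern; case: ifP => _; lra.
Qed.

Lemma bits_prob_prod p I (G : I -> bool -> R) :
  \sum_(c : {ffun I -> bool}) bits_prob p c * \prod_i G i (c i) =
  \prod_i \sum_b bern p b * G i b.
Proof.
rewrite bigA_distr_bigA /=; apply: eq_bigr => c _.
by rewrite /bits_prob -big_split.
Qed.

Lemma bits_prob_sum1 p I : \sum_(c : {ffun I -> bool}) bits_prob p c = 1.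
Proof.
have := bits_prob_prod p (fun (_ : I) (_ : bool) => 1) => /=.
under eq_bigr do rewrite big1_eq mulr1.
by move=> ->; apply: big1 => i _; under eq_bigr do rewrite mulr1; exact: bern_sum.
Qed.

Lemma bits_prob_marginal p I (G : I -> bool -> R) (i : I) :
  \sum_(c : {ffun I -> bool}) bits_prob p c * G i (c i) =
  \sum_b bern p b * G i b.
Proof.
transitivity (\sum_(c : {ffun I -> bool}) bits_prob p c *
   \prod_k (if k == i then G k (c k) else 1)).
  by apply: eq_bigr => c _; rewrite -big_mkcond big_pred1_eq.
rewrite (bits_prob_prod p (fun k b => if k == i then G k b else 1)).
rewrite (bigD1 i) //= eqxx [X in _ * X]big1 ?mulr1 // => k /negbTE ->.
by under eq_bigr do rewrite mulr1; exact: bern_sum.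
Qed.

Lemma bits_prob_eq p I J (e : J -> I) (d : {ffun J -> bool}) : injective e ->
  \sum_(c : {ffun I -> bool}) bits_prob p c * ([ffun j => c (e j)] == d)%:R =
  bits_prob p d.
Proof.
move=> inj_e.
(* The indicator of the event is split into one factor per index of [I]. By injectivity a factor
   carries at most one constraint, and it is the empty product outside the image of [e]. *)
pose G (i : I) (b : bool) : R := \prod_(j | e j == i) (b == d j)%:R.
transitivity (\sum_(c : {ffun I -> bool}) bits_prob p c * \prod_i G i (c i)).
  apply: eq_bigr => c _; congr (_ * _).
  transitivity (\prod_j (c (e j) == d j)%:R : R).
    apply/esym; case: eqP => [<-|ne]; first by rewrite big1 // => j _; rewrite ffunE eqxx.
    have [j cj] : exists j, c (e j) != d j.
      apply/existsP; apply/contra_notT: ne; rewrite negb_exists => /forallP ne.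
      by apply/ffunP => j; rewrite ffunE; apply/eqP; move: (ne j); rewrite negbK.
    by rewrite (bigD1 j) //= (negbTE cj) mul0r.
  rewrite (partition_big e predT) //=.
  by apply: eq_bigr => i _; apply: eq_bigr => j /eqP <-.
rewrite bits_prob_prod /bits_prob [RHS](partition_big e predT) //=.
apply: eq_bigr => i _; rewrite /G.
have [[j ej]|noj] := pselect (exists j, e j = i).
  have ej' k : (e k == i) = (k == j) by rewrite -ej (inj_eq inj_e).
  rewrite (eq_bigl _ _ ej') big_pred1_eq.
  under eq_bigr => b _ do rewrite (eq_bigl _ _ ej') big_pred1_eq.
  rewrite (bigD1 (d j)) //= eqxx mulr1 big1 ?addr0 // => b /negbTE ->.
  by rewrite mulr0.
have ej' k : (e k == i) = false by apply/eqP => ek; apply: noj; exists k.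
rewrite [RHS]big_pred0 //.
by under eq_bigr => b _ do rewrite big_pred0 // mulr1; exact: bern_sum.
Qed.

(** Used with [e] sending a block of the cycle to its last site: the noise on the L sites, read at
    these K distinct sites, is again a family of i.i.d. bits. *)
Lemma bits_prob_inj p I J (e : J -> I) (G : {ffun J -> bool} -> R) : injective e ->
  \sum_(c : {ffun I -> bool}) bits_prob p c * G [ffun j => c (e j)] =
  \sum_(d : {ffun J -> bool}) bits_prob p d * G d.
Proof.
move=> inj_e.
under [RHS]eq_bigr => d _ do rewrite -(bits_prob_eq p d inj_e) mulr_suml.
rewrite exchange_big /=; apply: eq_bigr => c _.
rewrite (bigD1 [ffun j => c (e j)]) //= eqxx mulr1 big1 ?addr0 // => d.
by rewrite eq_sym => /negbTE ->; rewrite mulr0 mul0r.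
Qed.

End Bits.

(** * The zero range process with parallel update *)

(* Release of a particle by a site holding n particles with random bit b. *)
Definition hop (n : nat) (b : bool) : bool := (n == 1%N) || ((2 < n)%N && b).

(** The values that [hop n] can take: both of them for n > 2, a forced one otherwise. *)
Definition hop_allowed (n : nat) (b : bool) : bool :=
  (2 < n)%N || (b == (n == 1%N)).

Section ZeroRange.
Variables (K N : nat) (heavy : pred 'I_K).
Local Notation state := {ffun 'I_K -> 'I_N.+1}.
Local Notation bits := {ffun 'I_K -> bool}.
Implicit Types (s : state) (J c : bits) (i : 'I_K).

Definition move s J : state :=
  [ffun i => inord (s i - J i + J (ord_pred i))%N].

Definition zrp_step s c : state := move s [ffun i => hop (s i) (c i)].

Definition zrp_states : {set state} :=
  [set s : state | [forall i, (1 < s i)%N == heavy i] & (\sum_i s i == N)%N].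

Definition allowed s J : bool := [forall i, hop_allowed (s i) (J i)].

Lemma zrp_statesP s :
  reflect ((forall i, (1 < s i)%N = heavy i) /\ (\sum_i s i = N)%N)
          (s \in zrp_states).
Proof.
rewrite inE; apply: (iffP andP) => -[h1 h2]; split.
- by move=> i; exact: eqP (forallP h1 i).
- exact/eqP.
- by apply/forallP => i; rewrite h1.
- exact/eqP.
Qed.

Lemma hop_allowed_hop n b : hop_allowed n (hop n b).
Proof. by case: n => [|[|[|n]]]; case: b. Qed.

Lemma hop_allowed_leq n b : hop_allowed n b -> (b <= n)%N.
Proof. by case: n => [|[|[|n]]]; case: b. Qed.

Lemma allowed_hop s c : allowed s [ffun i => hop (s i) (c i)].
Proof. by apply/forallP => i; rewrite ffunE hop_allowed_hop. Qed.

Lemma sum_move s J : allowed s J ->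
  (\sum_i (s i - J i + J (ord_pred i)) = \sum_i s i)%N.
Proof.
move=> /forallP sJ; rewrite big_split /=.
rewrite -(reindex_inj (h := @ord_pred K) (@ord_pred_inj K) (P := predT)
  (F := fun i => nat_of_bool (J i))) -big_split /=.
by apply: eq_bigr => i _; rewrite subnK // hop_allowed_leq.
Qed.

(** The [inord] in [move] truncates nothing, because a single occupation number is at most the
    conserved total N. *)
Lemma moveE s J i : s \in zrp_states -> allowed s J ->
  move s J i = (s i - J i + J (ord_pred i))%N :> nat.
Proof.
move=> /zrp_statesP[_ sN] sJ; rewrite ffunE inordK // ltnS -[leqRHS]sN -(sum_move sJ).
by rewrite (bigD1 i) //= leq_addr.
Qed.

(** The heavy set is invariant: a site with three or more particles loses at most one, a site with
    two loses none, a site with one loses it before gaining at most one, and an empty site gains at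
    most one. *)
Lemma move_zrp_states s J : s \in zrp_states -> allowed s J ->
  move s J \in zrp_states.
Proof.
move=> sD sJ; have [sh sN] := zrp_statesP _ sD; apply/zrp_statesP; split.
  move=> i; rewrite moveE // -sh.
  by have := forallP sJ i; rewrite /hop_allowed; case: (J i); case: (J _); lia.
by under eq_bigr => i _ do rewrite moveE //; rewrite sum_move.
Qed.

Lemma zrp_stepE s c i : s \in zrp_states ->
  zrp_step s c i =
    (s i - hop (s i) (c i) + hop (s (ord_pred i)) (c (ord_pred i)))%N :> nat.
Proof. by move=> sD; rewrite moveE ?allowed_hop // !ffunE. Qed.

Lemma zrp_step_states s c : s \in zrp_states -> zrp_step s c \in zrp_states.
Proof. by move=> sD; rewrite move_zrp_states ?allowed_hop. Qed.

(* Time reversal: a jump out of i is seen from the new state as a jump into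
   i + 1, and the allowed pairs are stable under this change of viewpoint. *)
Lemma allowed_move s J : s \in zrp_states -> allowed s J ->
  allowed (move s J) [ffun i => J (ord_pred i)].
Proof.
move=> sD sJ; have [sh sN] := zrp_statesP _ sD.
apply/forallP => i; rewrite moveE // ffunE.
have := forallP sJ i; rewrite /hop_allowed.
by case: (J i); case: (J _); lia.
Qed.

(** * The stationary product weight *)

Section Stationary.
Variables (R : realType) (p : R).
Hypothesis p01 : 0 < p < 1.
Local Notation beta := (p / (1 - p)).

(** The sum of beta^b over the allowed bits b: beta if n = 1, 1 + beta = 1 / (1 - p) if n > 2, and 1
    otherwise. *)
Definition site_weight (n : nat) : R :=
  if n == 1%N then p / (1 - p) else if (2 < n)%N then (1 - p)^-1 else 1.

Definition zrp_weight s : R := \prod_i site_weight (s i).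

Lemma site_weight_gt0 n : 0 < site_weight n.
Proof.
have p1 : 0 < 1 - p by move: p01; lra.
by rewrite /site_weight; case: ifP => _; [apply: divr_gt0 => //; move: p01; lra|];
  case: ifP => _ //; rewrite invr_gt0.
Qed.

Lemma zrp_weight_gt0 s : 0 < zrp_weight s.
Proof. by apply: prodr_gt0 => i _; exact: site_weight_gt0. Qed.

(** Given n, the released bit b has a law proportional to beta^b on the allowed values, and
    [site_weight n] is the normalizing constant. *)
Lemma site_weight_hop n (b : bool) :
  site_weight n * (\sum_a bern p a * (hop n a == b)%:R) =
  (hop_allowed n b)%:R * beta ^+ b.
Proof.
have p1 : 1 - p != 0 by move: p01; lra.
rewrite big_bool /bern /site_weight /hop /hop_allowed /beta.
case: n => [|[|[|n]]]; case: b; rewrite /= ?eqxx ?expr0 ?expr1;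
  try (by field).
by rewrite mulr0 addr0 mulr1 mul1r [LHS]mulrC.
Qed.

(** Product over the sites of [site_weight_hop]: the noise is integrated out, and only the set J of
    actual jumps remains, with weight beta^|J|. *)
Lemma weight_transfer s (G : bits -> R) :
  zrp_weight s * (\sum_c bits_prob p c * G [ffun i => hop (s i) (c i)]) =
  \sum_(J | allowed s J) (\prod_i beta ^+ J i) * G J.
Proof.
transitivity (\sum_J G J * \prod_i (site_weight (s i) *
     \sum_a bern p a * (hop (s i) a == J i)%:R)).
  under [RHS]eq_bigr => J _ do rewrite big_split /= -(bits_prob_prod p
     (fun i a => (hop (s i) a == J i)%:R)) mulrCA mulr_sumr.
  rewrite -mulr_sumr exchange_big /=; congr (_ * _); apply: eq_bigr => c _.
  rewrite (bigD1 [ffun i => hop (s i) (c i)]) //= big1 ?mulr1 => [|i _];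
    last by rewrite ffunE eqxx.
  rewrite big1 ?addr0 1?mulrC // => J nJ.
  suff [i ne] : exists i, hop (s i) (c i) != J i.
    by rewrite [X in _ * (_ * X)](bigD1 i) //= (negbTE ne) !(mul0r, mulr0).
  apply/existsP; apply: contraNT nJ; rewrite negb_exists => /forallP e.
  by apply/eqP/ffunP => i; rewrite ffunE; apply/esym/eqP; rewrite -[_ == _]negbK e.
rewrite [RHS]big_mkcond; apply: eq_bigr => J _.
under eq_bigr do rewrite site_weight_hop.
rewrite big_split /=; case: ifPn => sJ.
  by rewrite big1 ?mul1r 1?mulrC // => i _; rewrite (forallP sJ).
move: sJ; rewrite negb_forall => /existsP[i ni].
by rewrite [X in _ * (X * _)](bigD1 i) //= (negbTE ni) !mul0r mulr0.
Qed.

Lemma zrp_stationary (g : state -> R) :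
  \sum_(s in zrp_states) zrp_weight s * transfer (bits_prob p (I := _)) zrp_step g s =
  \sum_(s in zrp_states) zrp_weight s * g s.
Proof.
pose A := [set x : state * bits | (x.1 \in zrp_states) && allowed x.1 x.2].
have inA x : (x \in A) = (x.1 \in zrp_states) && allowed x.1 x.2 by rewrite finset.in_set.
(* The map keeps the number of jumps, hence the weight [wt]. It is injective on [A], since the
   shifted set determines J, and then J and the new state determine s; by finiteness it permutes
   [A]. *)
pose phi (x : state * bits) : state * bits := (move x.1 x.2, [ffun i => x.2 (ord_pred i)]).
pose wt (x : state * bits) : R := \prod_i beta ^+ x.2 i.
have phiA : phi @: A \subset A.
  apply/fintype.subsetP => _ /imsetP[[s J] + ->]; rewrite !inA /= => /andP[sD sJ].
  by rewrite move_zrp_states // allowed_move.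
have phi_inj : {in A &, injective phi}.
  move=> [s J] [s' J']; rewrite !inA /= => /andP[sD sJ] /andP[sD' sJ'] [em eJ].
  have eJJ : J = J'.
    by apply/ffunP => i; move/ffunP/(_ (ordS i)): eJ; rewrite !ffunE ordSK.
  subst J'; congr (_, _); apply/ffunP => i; apply/val_inj => /=.
  have := congr1 (fun f : state => nat_of_ord (f i)) em; rewrite !moveE //.
  have := hop_allowed_leq (forallP sJ i); have := hop_allowed_leq (forallP sJ' i).
  by lia.
have phiAE : phi @: A = A.
  by apply/eqP; rewrite eqEcard phiA card_in_imset // leqnn.
have sumA (F : state -> bits -> R) : \sum_(s in zrp_states) \sum_(J | allowed s J) F s J =
    \sum_(x in A) F x.1 x.2.
  by rewrite pair_big_dep /=; apply: eq_bigl => -[s J]; rewrite inA.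
under eq_bigr => s _ do rewrite /transfer /zrp_step (weight_transfer s (fun J => g (move s J))).
rewrite (sumA (fun s J => (\prod_i beta ^+ J i) * g (move s J))).
transitivity (\sum_(x in A) wt (phi x) * g (phi x).1).
  apply: eq_bigr => -[s J] _ /=; congr (_ * _); rewrite /wt /=.
  rewrite (reindex_inj (@ord_pred_inj K)) /=.
  by apply: eq_bigr => i _; rewrite ffunE.
rewrite -(big_imset (fun x => wt x * g x.1) phi_inj) /= phiAE.
rewrite -(sumA (fun s J => (\prod_i beta ^+ J i) * g s)).
apply: eq_bigr => s _; rewrite -(weight_transfer s (fun=> g s)) -mulr_suml.
by rewrite bits_prob_sum1 mul1r.
Qed.

End Stationary.

(** * A noise pattern that brings all states together *)

Section Coalescence.
Variable h0 : 'I_K.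
Hypothesis heavy_h0 : heavy h0.

(** Number of forward steps [ordS] from [i] to [h0] around the cycle. *)
Definition distance_to i : nat := if (i <= h0)%N then (h0 - i)%N else (h0 + K - i)%N.

Definition release_all_but : bits := [ffun i => i != h0].

Definition potential s : nat := (\sum_i distance_to i * s i)%N.

Lemma distance_toS i : i != h0 -> distance_to i = (distance_to (ordS i)).+1.
Proof.
move=> ih0; have {ih0} ih : (i : nat) <> h0 by move=> /val_inj e; rewrite e eqxx in ih0.
rewrite /distance_to /=; have := ltn_ord h0; have := ltn_ord i.
have [iK|iK] := ltnP i.+1 K.
  by rewrite modn_small //; case: (leqP i h0); case: (leqP i.+1 h0); lia.
have -> : (i.+1 %% K = 0)%N.
  by rewrite (_ : i.+1 = K) ?modnn //; have := ltn_ord i; lia.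
by rewrite leq0n; case: (leqP i h0); lia.
Qed.

(** Each jump brings one particle one step nearer to [h0]. No particle leaves [h0], the only site
    where a forward step would increase the distance: it holds at least two particles and its bit is
    false. *)
Lemma potential_step s : s \in zrp_states ->
  (potential (zrp_step s release_all_but) + \sum_(i | i != h0) hop (s i) true =
   potential s)%N.
Proof.
move=> sD; have [sh sN] := zrp_statesP _ sD; pose J i := hop (s i) (release_all_but i).
have Jh0 : J h0 = false.
  by rewrite /J /release_all_but ffunE eqxx /hop andbF orbF; have := sh h0;
    rewrite heavy_h0; lia.
have Js i : (J i <= s i)%N by exact: hop_allowed_leq (hop_allowed_hop _ _).
have splitD : (potential s = \sum_i distance_to i * (s i - J i) + \sum_i distance_to i * J i)%N.
  by rewrite -big_split /=; apply: eq_bigr => i _; rewrite -mulnDr subnK.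
have stepD : (potential (zrp_step s release_all_but) =
    \sum_i distance_to i * (s i - J i) + \sum_i distance_to (ordS i) * J i)%N.
  rewrite [X in (_ + X)%N](reindex_inj (@ord_pred_inj K)) -big_split /=.
  by apply: eq_bigr => i _; rewrite zrp_stepE // mulnDr ord_predK.
rewrite splitD stepD -addnA; congr (_ + _)%N.
rewrite (bigD1 h0) //= [in RHS](bigD1 h0) //= Jh0 !muln0 !add0n -big_split /=.
apply: eq_bigr => i ih0; rewrite [in RHS]distance_toS //= mulSn addnC.
by rewrite /J ffunE ih0.
Qed.

(* A state at rest under this noise has all its mobile particles at h0. *)
Lemma rest_unique s t : s \in zrp_states -> t \in zrp_states ->
  (forall i, i != h0 -> hop (s i) true = false) ->
  (forall i, i != h0 -> hop (t i) true = false) -> s = t.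
Proof.
move=> /zrp_statesP[sh sN] /zrp_statesP[th tN] hs ht.
have e i : i != h0 -> s i = t i.
  move=> ih0; apply/val_inj => /=; move: (hs i ih0) (ht i ih0) (sh i) (th i).
  by case: (nat_of_ord (s i)) (nat_of_ord (t i)) => [|[|[|a]]] [|[|[|b]]] //=;
    case: (heavy i).
apply/ffunP => i; have [->|/e //] := eqVneq i h0.
have est : (\sum_(i | i != h0) s i = \sum_(i | i != h0) t i)%N.
  by apply: eq_bigr => j /e ->.
move: sN tN; rewrite (bigD1 h0) //= [X in _ -> X = _ -> _](bigD1 h0) //= est => eN tN'.
by have /addIn/val_inj := etrans eN (esym tN').
Qed.

Lemma rest_step s : s \in zrp_states ->
  (forall i, i != h0 -> hop (s i) true = false) ->
  zrp_step s release_all_but = s.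
Proof.
move=> sD hs; have [sh sN] := zrp_statesP _ sD.
have J0 i : hop (s i) (release_all_but i) = false.
  rewrite ffunE; have [->|ih] /= := eqVneq i h0; last exact: hs.
  by rewrite /hop andbF orbF; have := sh h0; rewrite heavy_h0; lia.
by apply/ffunP => i; apply/val_inj; rewrite /= zrp_stepE // !J0 subn0 addn0.
Qed.

(** The potential drops by at least one in every step that does not start at rest, so more steps
    than its maximum lead every state to rest; the rest state is unique by [rest_unique]. *)
Lemma zrp_coalesce : exists n0 s0, {in zrp_states, forall s,
  iter n0 (zrp_step^~ release_all_but) s = s0}.
Proof.
have [[s1 s1D]|no] := pselect (exists s, s \in zrp_states); last first.
  by exists 0%N, [ffun=> ord0] => s sD; case: no; exists s.
pose n0 := (\max_s potential s).+1.
have rest s n : s \in zrp_states -> (potential s < n)%N ->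
    forall i, i != h0 ->
    hop (iter n (zrp_step^~ release_all_but) s i) true = false.
  elim: n s => // n IHn s sD sn; rewrite iterSr.
  have := potential_step sD.
  have [/eqP e0 _|pos e] := posnP (\sum_(i | i != h0) hop (s i) true)%N; last first.
    by apply: IHn; [exact: zrp_step_states | lia].
  have hs i : i != h0 -> hop (s i) true = false.
    by move: e0; rewrite sum_nat_eq0 => /forallP/(_ i)/implyP h /h; case: (hop _ _).
  rewrite (rest_step sD hs); suff -> : iter n (zrp_step^~ release_all_but) s = s by [].
  by elim: n {IHn sn} => //= n ->; exact: rest_step.
have lt_n0 s : (potential s < n0)%N by rewrite ltnS leq_bigmax.
exists n0, (iter n0 (zrp_step^~ release_all_but) s1) => s sD.
by apply: rest_unique; rewrite ?(iter_stepD zrp_step_states) //; exact: rest.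
Qed.

End Coalescence.

End ZeroRange.

(** * Counting the states with given numbers of singly occupied and long sites *)

(** Number of ways to write r as an ordered sum of k positive integers, including the one empty sum
    for k = r = 0. *)
Definition compositions (k r : nat) : nat :=
  match k, r with
  | 0, _ => r == 0%N
  | k'.+1, 0 => 0
  | k'.+1, r'.+1 => 'C(r', k')
  end.

Lemma sum_compositions k r : (\sum_(j < r.+1) compositions k j = 'C(r, k))%N.
Proof.
elim: r => [|r IHr]; first by rewrite big_ord1; case: k.
by rewrite big_ord_recr IHr /=; case: k {IHr} => [|k]; rewrite /= ?bin0 ?binS.
Qed.

(** Recursion on the size j of the first part. *)
Lemma compositionsS k r :
  (\sum_(j < r.+1) (0 < j) * compositions k (r - j) = compositions k.+1 r)%N.
Proof.
case: r => [|r]; first by rewrite big_ord1.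
rewrite big_ord_recl add0n -[RHS]sum_compositions.
rewrite [RHS](reindex_inj rev_ord_inj) /=.
by apply: eq_bigr => i _; rewrite mul1n.
Qed.

Lemma compositions_gt k r : (r < k)%N -> compositions k r = 0%N.
Proof. by case: k r => [|k] [|r] //= rk; rewrite bin_small. Qed.

Lemma compositions_gt0 k r :
  (0 < k <= r)%N || ((k == 0%N) && (r == 0%N)) -> (0 < compositions k r)%N.
Proof. by case: k r => [|k] [|r] //=; rewrite bin_gt0 orbF. Qed.

Lemma binz_nat (a b : nat) : binz a%:Z b%:Z = 'C(a, b).
Proof. by rewrite /binz /= lez_nat; case: leqP => // ab; rewrite bin_small. Qed.

(** Here [a] stands for L - N - M, the number of non-heavy sites. The two nonzero cases of
    [weight_count] merge into one formula because [compositions] covers k1 = 0 as well. *)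
Lemma weight_countE (a N M k1 k2 : nat) :
  weight_count (a + M + N) N M k1 k2 =
  ('C(a, k2) * 'C(M, k1) *
    (if k2 + 2 * M <= N then compositions k1 (N - (k2 + 2 * M)) else 0))%N.
Proof.
rewrite /weight_count (_ : (a + M + N)%N%:Z - N%:Z - M%:Z = a%:Z) ?binz_nat; last lia.
case: leqP => [le_N|lt_N]; last first.
  by rewrite muln0; case: ifP => [|_]; [lia | case: ifP => //; lia].
have -> : N%:Z - 2 * M%:Z - k2%:Z = (N - (k2 + 2 * M))%N%:Z by lia.
set r := (N - _)%N; case: k1 => [|k1]; first
  by case: r => [|r]; rewrite ?muln1 ?muln0 // bin0 muln1.
rewrite /= (_ : k1.+1%:Z - 1 = k1%:Z); last lia.
case: r => [|r]; first by rewrite muln0.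
rewrite (_ : r.+1%:Z - 1 = r%:Z) ?binz_nat /=; last lia.
by case: ifP => // kr; rewrite [X in (_ * X)%N]bin_small ?muln0 //; lia.
Qed.

Section Counting.
Variable R : realType.

(** The polynomial is the generating function of one positive part, cut off at degree n;
    coefficients of its powers below n do not see the cutoff. *)
Lemma coef_compositions n k r : (r < n)%N ->
  ((\poly_(j < n) (0 < j)%:R : {poly R}) ^+ k)`_r = (compositions k r)%:R.
Proof.
elim: k r => [|k IHk] r rn; first by rewrite expr0 coef1.
rewrite exprS coefM -compositionsS natr_sum; apply: eq_bigr => j _.
rewrite coef_poly IHk; last exact: leq_ltn_trans (leq_subr _ _) rn.
by rewrite (leq_ltn_trans _ rn) -?natrM // -ltnS.
Qed.

Lemma sum_subsets (I : finType) (X : {set I}) n (G : nat -> R) :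
  (forall k, (n <= k)%N -> G k = 0) ->
  \sum_(A : {set I} | A \subset X) G #|A| = \sum_(0 <= k < n) 'C(#|X|, k)%:R * G k.
Proof.
move=> G0; rewrite big_mkord.
transitivity (\sum_(A : {set I} | A \subset X) \sum_(k < n | #|A| == k) G k).
  apply: eq_bigr => A _; have [An|nA] := ltnP #|A| n.
    by rewrite (eq_bigl (pred1 (Ordinal An))) ?big_pred1_eq // => k; rewrite eq_sym.
  by rewrite G0 // big1 // => k /eqP; have := ltn_ord k; lia.
rewrite (exchange_big_dep predT) //=; apply: eq_bigr => k _.
by rewrite -cards_draws -sum1_card natr_sum mulr_suml; apply: eq_big => [A|A _];
  rewrite ?inE ?mul1r.
Qed.

Variables (K N : nat) (heavy : pred 'I_K).
Local Notation state := {ffun 'I_K -> 'I_N.+1}.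
Local Notation H := [set i | heavy i].
Hypotheses (heavy_gt0 : (0 < #|H|)%N) (N_gt1 : (1 < N)%N).
Implicit Types (s : state) (i : 'I_K).

Definition singles s : {set 'I_K} := [set i | s i == 1%N :> nat].
Definition longs s : {set 'I_K} := [set i | (2 < s i)%N].

(** Once the sets A of single sites and B of long sites are fixed, a state is described by
    independent conditions on the sites together with the total. The generating function in
    [card_fits] is therefore a product over the sites. *)
Definition fits (A B : {set 'I_K}) i (n : nat) : bool :=
  if heavy i then (if i \in B then (2 < n)%N else n == 2%N)
  else n == (i \in A).

Lemma fitsP (A B : {set 'I_K}) s : (A \subset ~: H) && (B \subset H) ->
  (s \in zrp_states N heavy) && ((singles s, longs s) == (A, B)) =
  [forall i, fits A B i (s i)] && (\sum_i s i == N)%N.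
Proof.
move=> /andP[/fintype.subsetP AH /fintype.subsetP BH].
apply/andP/andP => -[].
  move=> /zrp_statesP[sh sN] /eqP[<- <-]; rewrite sN; split=> //.
  apply/forallP => i; rewrite /fits !inE -sh.
  by case: (nat_of_ord (s i)) => [|[|[|n]]].
move=> /forallP f sN.
have f' i : heavy i = (1 < s i)%N /\ (i \in A) = (s i == 1%N :> nat) /\
    (i \in B) = (2 < s i)%N.
  move: (f i) (AH i) (BH i); rewrite /fits !inE.
  case: (heavy i) => /=.
    case: (i \in A) => [_ /(_ isT) //|].
    by case: (i \in B); case: (nat_of_ord (s i)) => [|[|[|n]]].
  case: (i \in B) => [_ _ /(_ isT) //|].
  by case: (i \in A); case: (nat_of_ord (s i)) => [|[|[|n]]].
split.
  apply/zrp_statesP; split; last exact/eqP.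
  by move=> i; case: (f' i) => ->.
by apply/eqP; congr (_, _); apply/setP => i; rewrite inE; case: (f' i) => _ [eA eB].
Qed.

Lemma card_fits (A B : {set 'I_K}) : (A \subset ~: H) && (B \subset H) ->
  \sum_(s : state | [forall i, fits A B i (s i)] && (\sum_i s i == N)%N) (1 : R) =
  if (#|A| + 2 * #|H| <= N)%N
  then (compositions #|B| (N - (#|A| + 2 * #|H|)))%:R else 0.
Proof.
move=> /andP[AH BH].
pose P : {poly R} := \poly_(j < N.-1) (0 < j)%:R.
transitivity ((\prod_i \sum_(j : 'I_N.+1) (fits A B i j)%:R *: 'X^j : {poly R})`_N).
  rewrite bigA_distr_bigA coef_sum big_mkcond; apply: eq_bigr => s _ /=.
  have -> : \prod_i ((fits A B i (s i))%:R *: 'X^(s i)) =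
     [forall i, fits A B i (s i)]%:R *: 'X^(\sum_i s i) :> {poly R}.
    have [/forallP f|] := boolP [forall i, fits A B i (s i)].
      rewrite scale1r -prodrXr; apply: eq_bigr => i _.
      by rewrite f scale1r.
    rewrite negb_forall => /existsP[i ni].
    by rewrite (bigD1 i) //= (negbTE ni) !scale0r mul0r.
  rewrite coefZ coefXn eq_sym; case: [forall i, _]; case: eqP => //= _;
    by rewrite ?mulr1 ?mulr0 ?mul0r.
have factor i : \sum_(j : 'I_N.+1) (fits A B i j)%:R *: 'X^j =
    'X^((i \in A) + 2 * heavy i) * P ^+ (i \in B) :> {poly R}.
  rewrite -(poly_def N.+1 (fun j => (fits A B i j)%:R)); apply/polyP => m.
  rewrite coef_poly /fits; move/fintype.subsetP/(_ i): AH; move/fintype.subsetP/(_ i): BH.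
  rewrite !inE; case: (heavy i); case: (i \in A); case: (i \in B) => // hB hA;
    try (by have := hB isT); try (by have := hA isT);
    rewrite ?(expr0, expr1, mulr1) ?(coefXnM, coefXn) ?coef_poly.
  - case: (ltnP m N.+1) => mN; case: (ltnP m (0 + 2 * 1)) => m2;
    case: (ltnP (m - (0 + 2 * 1)) N.-1) => mN2;
    case: (ltnP 2 m) => m3; case: (ltnP 0 (m - (0 + 2 * 1))) => m4;
    by [|exfalso; lia].
  - by rewrite ?coefX ?coef1; case: (ltnP m N.+1) => // mN; case: eqP => // e; exfalso; lia.
  - by rewrite ?coefX ?coef1; case: (ltnP m N.+1) => // mN; case: eqP => // e; exfalso; lia.
  - by rewrite ?coefX ?coef1; case: (ltnP m N.+1) => // mN; case: eqP => // e; exfalso; lia.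
rewrite (eq_bigr _ (fun i _ => factor i)) big_split /= !prodrXr.
have -> : (\sum_i ((i \in A) + 2 * heavy i) = #|A| + 2 * #|H|)%N.
  rewrite big_split /= -big_distrr /= -!sum1_card; congr (_ + 2 * _)%N.
    by rewrite [RHS]big_mkcond; apply: eq_bigr => i _; case: (i \in A).
  by rewrite [RHS]big_mkcond; apply: eq_bigr => i _; rewrite inE; case: (heavy i).
have -> : (\sum_i (i \in B) = #|B|)%N.
  by rewrite -sum1_card [RHS]big_mkcond; apply: eq_bigr => i _; case: (i \in B).
rewrite coefXnM ltnNge if_neg; case: ifP => // le_N.
(* As [H] is nonempty, the remaining degree is at most N - 2, below the cutoff of [P]. *)
by rewrite coef_compositions //; lia.
Qed.

(** States are grouped by their long sites (a subset of [H]) and single sites (a subset of the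
    complement). By [card_fits] the size of a group depends only on the two cardinalities, and
    choosing the subsets gives the two remaining binomials. *)
Lemma sum_zrp_states (F : nat -> nat -> R) :
  \sum_(s in zrp_states N heavy) F #|longs s| #|singles s| =
  \sum_(0 <= k1 < N.+1) \sum_(0 <= k2 < N.+1)
    F k1 k2 * (weight_count (K + N) N #|H| k1 k2)%:R.
Proof.
pose G k1 k2 : R := F k1 k2 * (if (k2 + 2 * #|H| <= N)%N
  then (compositions k1 (N - (k2 + 2 * #|H|)))%:R else 0).
have GE k1 k2 : F k1 k2 * (weight_count (K + N) N #|H| k1 k2)%:R =
    'C(#|H|, k1)%:R * ('C(#|~: H|, k2)%:R * G k1 k2).
  have -> : (K + N = #|~: H| + #|H| + N)%N by rewrite [(#|~: H| + _)%N]addnC cardsC card_ord.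
  rewrite weight_countE /G !natrM; case: ifP => _; ring.
have G0 k1 k2 : (N < k2)%N -> G k1 k2 = 0.
  by move=> Nk; rewrite /G ifF ?mulr0 //; lia.
have G0' k1 k2 : (N < k1)%N -> G k1 k2 = 0.
  move=> Nk; rewrite /G; case: ifP; rewrite ?mulr0 // => _.
  by rewrite compositions_gt ?mulr0 //; lia.
transitivity (\sum_(B : {set 'I_K} | B \subset H)
    \sum_(A : {set 'I_K} | A \subset ~: H) G #|B| #|A|); last first.
  rewrite (@sum_subsets _ _ N.+1 (fun k1 => \sum_(A : {set 'I_K} | A \subset ~: H) G k1 #|A|)).
    apply: eq_bigr => k1 _; rewrite (@sum_subsets _ _ N.+1 (G k1)).
      by rewrite mulr_sumr; apply: eq_bigr => k2 _; rewrite GE.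
    by move=> k; exact: G0.
  by move=> k Nk; apply: big1 => A _; exact: G0'.
rewrite pair_big /= (partition_big (fun s => (longs s, singles s))
  (fun X => (X.1 \subset H) && (X.2 \subset ~: H))) /=; last first.
  move=> s /zrp_statesP[sh _]; apply/andP; split; apply/fintype.subsetP => i;
    rewrite !inE -sh; first exact: ltnW.
  by move=> /eqP ->.
apply: eq_bigr => -[B A] /= /andP[BH AH]; rewrite /G -card_fits ?AH // mulr_sumr.
apply: eq_big => [s|s /andP[_ /eqP[-> ->]]]; last by rewrite mulr1.
by rewrite -fitsP ?AH // !xpair_eqE [X in _ && X]andbC.
Qed.

Lemma zrp_weightE (p : R) s : 0 < p < 1 -> zrp_weight p s =
  p ^+ #|singles s| / (1 - p) ^+ (#|longs s| + #|singles s|).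
Proof.
move=> p01; have p1 : 1 - p != 0 by lra.
have -> : zrp_weight p s = \prod_i (p ^+ (s i == 1%N :> nat) *
    (1 - p)^-1 ^+ ((2 < s i) + (s i == 1%N :> nat))).
  apply: eq_bigr => i _; rewrite /site_weight.
  by case: (nat_of_ord (s i)) => [|[|[|n]]] /=;
    rewrite ?expr0 ?expr1 ?mulr1 ?mul1r.
rewrite big_split /= !prodrXr big_split /= exprVn.
by congr (_ ^+ _ / _ ^+ (_ + _)); rewrite -sum1_card [RHS]big_mkcond;
  apply: eq_bigr => i _; rewrite inE; case: ifP => // ->.
Qed.

Definition mean_hops (p : R) s : R :=
  \sum_(c : {ffun 'I_K -> bool}) bits_prob p c * (\sum_i (hop (s i) (c i))%:R).

Lemma mean_hopsE (p : R) s : mean_hops p s = p * #|longs s|%:R + #|singles s|%:R.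
Proof.
rewrite /mean_hops.
under eq_bigr => c _ do rewrite mulr_sumr.
rewrite exchange_big /= (eq_bigr (fun i => p * (2 < s i)%N%:R + (s i == 1%N :> nat)%:R)).
  rewrite big_split /= -mulr_sumr -!natr_sum.
  by congr (_ * _%:R + _%:R); rewrite -sum1_card [RHS]big_mkcond;
    apply: eq_bigr => i _; rewrite inE; case: ifP => // ->.
move=> i _; rewrite (bits_prob_marginal p (fun i b => (hop (s i) b)%:R)) big_bool /bern /=.
by case: (nat_of_ord (s i)) => [|[|[|n]]] /=; rewrite /hop /=; ring.
Qed.

End Counting.

(** * The limiting mean number of jumps of the zero range process *)

Section Limit.
Local Open Scope classical_set_scope.

Lemma zrp_transfer_cvg (R : realType) (K N : nat) (heavy : pred 'I_K) (p : R)
    (s : {ffun 'I_K -> 'I_N.+1}) :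
  (0 < #|[set i | heavy i]%SET|)%N -> (1 < N)%N -> 0 < p < 1 ->
  s \in zrp_states N heavy ->
  iter n (transfer (bits_prob p (I := _)) (@zrp_step K N)) (mean_hops p) s
    @[n --> \oo] --> (K + N)%:R * flux_formula (K + N) N #|[set i | heavy i]%SET| p.
Proof.
move=> H_gt0 N_gt1 p01 sD; have /card_gt0P[h0 hh0] := H_gt0.
have {}hh0 : heavy h0 by rewrite inE in hh0.
have [n0 [s0 coal]] := zrp_coalesce N hh0.
have := transfer_cvg (f := mean_hops p) (fun c => ltW (bits_prob_gt0 c p01)) (bits_prob_sum1 p _)
  (fun s c => @zrp_step_states K N heavy s c) (bits_prob_gt0 _ p01) coal
  (fun s _ => zrp_weight_gt0 p01 s) (@zrp_stationary K N heavy R p p01) sD.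
suff -> : (K + N)%:R * flux_formula (K + N) N #|[set i | heavy i]%SET| p =
  (\sum_(t in zrp_states N heavy) zrp_weight p t * mean_hops p t) /
  (\sum_(t in zrp_states N heavy) zrp_weight p t) by [].
rewrite /flux_formula mulVKf ?pnatr_eq0; last lia.
pose W k1 k2 : R := p ^+ k2 / (1 - p) ^+ (k1 + k2).
rewrite (eq_bigr (fun t => (p * #|longs t|%:R + #|singles t|%:R) * W #|longs t| #|singles t|)).
  rewrite [X in _ = _ / X](eq_bigr (fun t => W #|longs t| #|singles t|)).
    rewrite !(sum_zrp_states H_gt0 N_gt1 (fun k1 k2 => (p * k1%:R + k2%:R) * W k1 k2)).
    rewrite (sum_zrp_states H_gt0 N_gt1 W).
    by congr (_ / _); do 2!apply: eq_bigr => ? _; rewrite mulrA.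
  by move=> t _; rewrite zrp_weightE.
by move=> t _; rewrite zrp_weightE // mulrC mean_hopsE.
Qed.

End Limit.

(** * Blocks of the cycle, and the v-dynamics read on block lengths *)

Lemma iter_ordSE (L : nat) (j : 'I_L) m : iter m (@ordS L) j = ((j + m) %% L)%N :> nat.
Proof.
elim: m => [|m IHm] /=; first by rewrite addn0 modn_small.
by rewrite IHm -addn1 modnDml addn1 addnS.
Qed.

Lemma iter_ordS_pred (L : nat) (j : 'I_L) m :
  iter m.+1 (@ordS L) (ord_pred j) = iter m (@ordS L) j.
Proof. by rewrite iterSr ord_predK. Qed.

Lemma iter_ordS_period (L : nat) (j : 'I_L) : iter L (@ordS L) j = j.
Proof. by apply/val_inj; rewrite /= iter_ordSE modnDr modn_small. Qed.

Lemma iter_ordS_inj (L : nat) (j : 'I_L) :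
  injective (fun m : 'I_L => iter m (@ordS L) j).
Proof.
move=> m m' /(congr1 val); rewrite /= !iter_ordSE => /eqP.
by rewrite eqn_modDl !modn_small // => /eqP/val_inj.
Qed.

(* The sites of the cycle cut into blocks 0 1^(n i); the i-th block starts at
   the site z i. *)
Definition lifts (L K : nat) (x : config L) (z : 'I_K -> 'I_L) (n : 'I_K -> nat) :=
  [/\ forall i, z (ordS i) = iter (n i).+1 (@ordS L) (z i),
      forall i t, (t <= n i)%N -> x (iter t (@ordS L) (z i)) = (0 < t)%N
    & (\sum_i (n i).+1 = L)%N].

Section Lift.
Variables (L K : nat) (x : config L) (z : 'I_K -> 'I_L) (n : 'I_K -> nat).
Hypothesis xzn : lifts x z n.

Lemma sum_sites (F : 'I_L -> nat) :
  (\sum_j F j = \sum_i \sum_(t < (n i).+1) F (iter t (@ordS L) (z i)))%N.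
Proof.
have [zS _ sumL] := xzn; case: K z n zS sumL => [|k] z' n' zS sumL.
  by rewrite big_ord0 in sumL; rewrite big_ord0 big1 // => j; have := ltn_ord j; lia.
(* [S m] is the offset of the zero of block m from the zero of block 0; walking [S k.+1 = L] sites
   from there visits each site once. *)
pose S m := (\sum_(0 <= i < m) (n' (inord i)).+1)%N.
have zE m : (m < k.+1)%N -> z' (inord m) = iter (S m) (@ordS L) (z' ord0).
  elim: m => [|m IHm] mk; first by rewrite /S big_nil; congr z'; apply/val_inj; rewrite /= inordK.
  rewrite /S big_nat_recr //= -/(S m) addnC iterD -IHm; last exact: ltnW.
  by rewrite -zS; congr z'; apply/val_inj; rewrite /= !inordK ?modn_small // ltnW.
have sumE m : (m <= k.+1)%N ->
  (\sum_(0 <= j < S m) F (iter j (@ordS L) (z' ord0)) =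
   \sum_(0 <= i < m) \sum_(t < (n' (inord i)).+1) F (iter t (@ordS L) (z' (inord i))))%N.
  elim: m => [|m IHm] mk; first by rewrite /S !big_nil.
  rewrite [RHS]big_nat_recr //= -IHm 1?ltnW // /S big_nat_recr //= -/(S m).
  rewrite (big_cat_nat (n := S m)) ?leq_addr //=; congr (_ + _)%N.
  rewrite -{1}[S m]add0n big_addn addKn big_mkord; apply: eq_bigr => t _.
  by rewrite iterD zE.
have SL : S k.+1 = L.
  by rewrite /S big_mkord -[RHS]sumL; apply: eq_bigr => i _; rewrite inord_val.
rewrite (reindex_inj (@iter_ordS_inj L (z' ord0))) /=.
have := sumE _ (leqnn _); rewrite SL !big_mkord => ->.
by apply: eq_bigr => i _; rewrite inord_val.
Qed.

Let last_site i := iter (n i) (@ordS L) (z i).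

Lemma next_last_site i : ordS (last_site i) = z (ordS i).
Proof. by have [-> _ _] := xzn. Qed.

(** A site that were the last one of two blocks would be counted twice by [sum_sites]. *)
Lemma last_site_inj : injective last_site.
Proof.
move=> i i' eii; apply/eqP; apply: contraT => ne.
have := sum_sites (fun j => j == last_site i); rewrite (bigD1 (last_site i)) //= eqxx.
rewrite big1 => [|j /negbTE -> //]; rewrite (bigD1 i) //= (bigD1 i') 1?eq_sym //=.
rewrite big_ord_recr [X in (_ + (X + _))%N]big_ord_recr /= eii eqxx -/(last_site i) -eii eqxx.
by lia.
Qed.

Lemma site_before t i : (0 < t)%N ->
  ord_pred (iter t (@ordS L) (z i)) = iter t.-1 (@ordS L) (z i).
Proof. by case: t => //= t _; rewrite ordSK. Qed.

Lemma next_site i t : (t <= n i)%N ->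
  x (ordS (iter t (@ordS L) (z i))) = (t != n i).
Proof.
have [zS xE _] := xzn; rewrite leq_eqVlt; have [->|/= _ tn] := eqVneq t (n i).
  by rewrite next_last_site (xE _ 0%N).
by rewrite (xE _ t.+1).
Qed.

(** A one can move only if a zero follows it, so only from the end of its block. There the two
    preceding sites tell whether the run has length one, two or more, which is all that [hop]
    depends on. *)
Lemma local_fluxE (c : 'I_L -> bool) i t : (t <= n i)%N ->
  local_flux q_rule c x (iter t (@ordS L) (z i)) =
  (t == n i) && hop (n i) (c (last_site i)).
Proof.
move=> tn; have [zS xE _] := xzn; rewrite /local_flux next_site // xE //.
have [->|_] /= := eqVneq t (n i); last by case: (x _); case: (x _); case: (_ < _)%N.
rewrite -/(last_site i); case ni: (n i) => [|[|m]] /=.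
- by case: (x _); case: (x _).
- rewrite /last_site ni /= ordSK (xE _ 0%N) //.
  by case: (x _).
rewrite /last_site ni !iterS !ordSK (xE i m) ?(xE i m.+1) ?(xE i m.+2) ?ni //.
exact: leqW.
Qed.

Lemma total_flux (c : 'I_L -> bool) :
  (\sum_j local_flux q_rule c x j = \sum_i hop (n i) (c (last_site i)))%N.
Proof.
rewrite sum_sites; apply: eq_bigr => i _; rewrite big_ord_recr /= local_fluxE // eqxx.
by rewrite big1 ?add0n // => t _; rewrite local_fluxE 1?ltnW // ltn_eqF.
Qed.

Lemma total_ones : (\sum_j x j = \sum_i n i)%N.
Proof.
have [_ xE _] := xzn; rewrite sum_sites; apply: eq_bigr => i _.
rewrite big_ord_recl /= (xE _ 0%N) // add0n -[RHS]mul1n -[in RHS](card_ord (n i)) mulnC.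
rewrite -sum_nat_const; apply: eq_bigr => t _.
by rewrite -[ordS _]/(iter t.+1 _ _) xE.
Qed.

Lemma total_110 : word_count [:: true; true; false] x = #|[set i | (1 < n i)%N]|.
Proof.
have [_ xE _] := xzn.
rewrite /word_count -!sum1_card [LHS]big_mkcond [RHS]big_mkcond /=.
rewrite (reindex_inj (@ord_pred_inj L)) sum_sites; apply: eq_bigr => i _.
have E t : (t <= n i)%N -> (ord_pred (iter t (@ordS L) (z i)) \in
    [pred j | word_at x 3 j == [:: true; true; false]]) = (t == n i) && (1 < n i)%N.
  move=> tn; rewrite inE /word_at /= ord_predK next_site // xE //.
  rewrite !eqseq_cons eqxx andbT.
  have [->|_] /= := eqVneq t (n i); last by rewrite !andbF.
  case ni: (n i) => [|m]; first by rewrite andbF.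
  by rewrite iterS ordSK xE ?ni //= andbT; case: m {ni}; rewrite ?eqxx.
rewrite big_ord_recr /= E // eqxx inE big1 ?add0n // => t _.
by rewrite E ?ltn_eqF // ltnW.
Qed.

(** Boolean form of the integer update equation; [v_step_balance] and [v_step_unique] relate the
    two. *)
Definition v_step (y c : config L) : config L :=
  [ffun j => local_flux q_rule c y (ord_pred j) || (y j && ~~ local_flux q_rule c y j)].

(** The site after the end of block i - 1 is the zero [z i]. A one released by that block exchanges
    places with this zero, so the zero moves one site back and block i gains a one at its front. *)
Lemma lifts_step (c : config L) :
  let J i := hop (n i) (c (last_site i)) in
  lifts (v_step x c)
    (fun i => if J (ord_pred i) then ord_pred (z i) else z i)
    (fun i => n i - J i + J (ord_pred i))%N.
Proof.
move=> J; have [zS xE sumL] := xzn.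
have Jn i : (J i <= n i)%N by exact/hop_allowed_leq/hop_allowed_hop.
have q_before i : local_flux q_rule c x (ord_pred (z i)) = J (ord_pred i).
  rewrite -[in LHS](ord_predK i) zS /= ordSK local_fluxE // eqxx //.
have x_inside i t : (0 < t <= n i - J i)%N -> v_step x c (iter t (@ordS L) (z i)).
  move=> /andP[t0 tn]; rewrite ffunE; apply/orP; right.
  rewrite xE ?t0 /= ?local_fluxE; try lia.
  by apply/negP => /andP[/eqP tE]; rewrite -/(J i) => Ji; move: tn; rewrite Ji; lia.
split.
- move=> i; rewrite ordSK zS; have := Jn i.
  case: (J (ord_pred i)); case: (J i) => /= Jni; rewrite ?addn0 ?addn1 ?subn0.
  + by rewrite subn1 prednK // ordSK -iterS iterSr ord_predK.
  + by apply/esym; exact: (iter_ordS_pred (z i) (n i).+1).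
  + by rewrite ordSK subn1 -iterS prednK.
  + by [].
- move=> i [|t] /=.
    move=> _; case: ifP => Jp; last first.
      by rewrite ffunE q_before Jp /= (xE _ 0%N).
    have := Jn (ord_pred i); rewrite Jp => n0.
    rewrite ffunE q_before Jp andbF orbF -[in z i](ord_predK i) zS /= ordSK.
    by rewrite site_before // local_fluxE; [rewrite ltn_eqF // | ]; lia.
  case: ifP => Jp; last by rewrite addn0 => tn; rewrite (x_inside _ t.+1).
  rewrite -iterS iterSr ord_predK => tn; case: t tn => [|t] tn /=.
    by rewrite ffunE q_before Jp.
  by rewrite (x_inside _ t.+1) //; lia.
rewrite -[RHS]sumL; under eq_bigr => i _ do rewrite -addn1.
under [RHS]eq_bigr => i _ do rewrite -addn1.
rewrite 2![in LHS]big_split [RHS]big_split /=; congr (_ + _)%N.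
rewrite -(reindex_inj (h := @ord_pred K) (@ord_pred_inj K) (P := predT)
  (F := fun i => nat_of_bool (J i))) -big_split /=.
by apply: eq_bigr => i _; rewrite subnK.
Qed.

End Lift.

Definition mean_flux (R : realType) (L : nat) (p : R) (x : config L) : R :=
  \sum_(c : config L) bits_prob p c * (\sum_j (local_flux q_rule c x j)%:R).

(** The flux depends on the block lengths alone, and the bits at the ends of the blocks are i.i.d.
    by [bits_prob_inj]. The positions [z] vary with the noise, so the induction is over all of
    them. *)
Lemma transfer_lift (R : realType) (p : R) (L K N : nat) (heavy : pred 'I_K) k
    (x : config L) z (s : {ffun 'I_K -> 'I_N.+1}) :
  s \in zrp_states N heavy -> lifts x z (fun i => s i : nat) ->
  iter k (transfer (bits_prob p (I := _)) (@v_step L)) (mean_flux p) x =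
  iter k (transfer (bits_prob p (I := _)) (@zrp_step K N)) (mean_hops p) s.
Proof.
elim: k => [|k IHk] in x z s * => sD xzs.
  rewrite /= /mean_flux /mean_hops.
  rewrite -[RHS](bits_prob_inj p (fun d : {ffun 'I_K -> bool} =>
    \sum_i (hop (s i) (d i))%:R) (last_site_inj xzs)).
  apply: eq_bigr => c _; rewrite -!natr_sum (total_flux xzs c).
  by congr (_ * _%:R); apply: eq_bigr => i _; rewrite ffunE.
rewrite /= /transfer -[RHS](bits_prob_inj p (fun d : {ffun 'I_K -> bool} =>
    iter k (transfer (bits_prob p (I := _)) (@zrp_step K N)) (mean_hops p) (zrp_step s d))
    (last_site_inj xzs)).
apply: eq_bigr => c _; congr (_ * _).
have /= := lifts_step xzs c; set z' := (X in lifts _ X _) => h.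
apply: (IHk _ z'); first exact: zrp_step_states.
case: h => h1 h2 h3; have E i : (s i - hop (s i) (c (iter (s i) (@ordS L) (z i))) +
  hop (s (ord_pred i)) (c (iter (s (ord_pred i)) (@ordS L) (z (ord_pred i)))))%N =
  zrp_step s [ffun j => c (iter (s j) (@ordS L) (z j))] i.
  by rewrite (zrp_stepE _ _ sD) !ffunE.
split.
- by move=> i; rewrite h1 E.
- by move=> i t ti; apply: h2; rewrite E.
by rewrite -[RHS]h3; apply: eq_bigr => i _; rewrite E.
Qed.

(** * Every configuration with a zero has a block decomposition *)

Definition run_word (ns : seq nat) : seq bool := flatten [seq false :: nseq n true | n <- ns].

Lemma run_wordP (w : seq bool) : exists a ns, w = nseq a true ++ run_word ns.
Proof.
elim: w => [|[|] w [a [ns ->]]]; first by exists 0%N, [::].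
  by exists a.+1, ns.
by exists 0%N, (a :: ns).
Qed.

Definition run_start (ns : seq nat) k : nat := sumn (take k (map succn ns)).

Lemma nth_run_word ns k t : (k < size ns)%N -> (t <= nth 0%N ns k)%N ->
  nth false (run_word ns) (run_start ns k + t) = (0 < t)%N.
Proof.
rewrite /run_start /run_word; elim: ns k => //= n ns IHns [|k] /= kn tn.
  rewrite add0n -cat_cons nth_cat /= size_nseq ltnS tn.
  by case: t {IHns} tn => //= t tn; rewrite nth_nseq tn.
rewrite -[RHS](IHns k) // nth_cat size_nseq ifF; last by lia.
by congr nth; lia.
Qed.

Lemma size_run_word ns : size (run_word ns) = sumn (map succn ns).
Proof.
by rewrite /run_word; elim: ns => //= n ns IHns; rewrite size_cat size_nseq IHns.
Qed.

(** Read from a zero, the cycle becomes a word without leading ones, hence a concatenation of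
    blocks; the last block closes up with the first because the total length is L. *)
Lemma exists_lift (L : nat) (x : config L) (p : 'I_L) : x p = false ->
  exists K (z : 'I_K -> 'I_L) n, lifts x z n.
Proof.
move=> xp; pose w := [seq x (iter t (@ordS L) p) | t <- iota 0 L].
have wE t : (t < L)%N -> nth false w t = x (iter t (@ordS L) p).
  by move=> tL; rewrite (nth_map 0%N) ?size_iota // nth_iota.
have [a [ns wns]] := run_wordP w.
have a0 : a = 0%N.
  case: a wns => // a wns; have := wE 0%N (leq_ltn_trans (leq0n p) (ltn_ord p)).
  by rewrite wns /= xp.
rewrite a0 /= in wns.
have sumL : sumn (map succn ns) = L by rewrite -size_run_word -wns size_map size_iota.
have startS k : (k < size ns)%N ->
    run_start ns k.+1 = (run_start ns k + (nth 0%N ns k).+1)%N.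
  move=> kn; rewrite /run_start (take_nth 0%N) ?size_map // sumn_rcons.
  by rewrite (nth_map 0%N).
exists (size ns), (fun i => iter (run_start ns i) (@ordS L) p),
  (fun i : 'I__ => nth 0%N ns i).
split.
- move=> i; rewrite -iterD addnC -startS //=.
  have [iK|iK] := ltnP i.+1 (size ns); first by rewrite modn_small.
  have -> : i.+1 = size ns by have := ltn_ord i; lia.
  by rewrite modnn /run_start take0 take_oversize ?size_map // sumL iter_ordS_period.
- move=> i t ti; rewrite -iterD addnC -wE; last first.
    rewrite -sumL -[map _ _](cat_take_drop i.+1) sumn_cat -/(run_start ns i.+1) startS //.
    by lia.
  by rewrite wns nth_run_word.
by rewrite -[RHS]sumL sumnE big_map (big_nth 0%N) big_mkord.
Qed.

Lemma word_count1 (L : nat) (x : config L) : word_count [:: true] x = (\sum_j x j)%N.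
Proof.
rewrite /word_count -sum1_card big_mkcond /=; apply: eq_bigr => j _.
by rewrite inE /word_at /= eqseq_cons andbT; case: (x j).
Qed.

Lemma has_counts_lift (L N M : nat) (x : config L) :
  (N < L)%N -> has_counts N M x ->
  exists K (z : 'I_K -> 'I_L) n, [/\ lifts x z n, (\sum_i n i = N)%N,
    (L = K + N)%N & #|[set i | (1 < n i)%N]| = M].
Proof.
move=> NL [xN xM].
have [q xq] : exists q, x q = false.
  have [//|no] := pselect (exists q, x q = false).
  move: xN; rewrite word_count1 (eq_bigr (fun=> 1%N)) => [|j _].
    by rewrite sum1_card card_ord; lia.
  by have [//|/negbTE xj] := boolP (x j); case: no; exists j.
have [K [z [n xzn]]] := exists_lift xq.
have sumN : (\sum_i n i = N)%N by rewrite -(total_ones xzn) -word_count1.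
exists K, z, n; split => //; last by rewrite -xM (total_110 xzn).
have [_ _ <-] := xzn; under eq_bigr => i _ do rewrite -addn1.
by rewrite big_split /= sumN sum1_card card_ord addnC.
Qed.

Section FluxLimit.
Local Open Scope classical_set_scope.

Lemma mean_flux_cvg (R : realType) (L N M : nat) (p : R) (x : config L) :
  admissible L N M -> 0 < p < 1 -> has_counts N M x ->
  iter n (transfer (bits_prob p (I := _)) (@v_step L)) (mean_flux p) x
    @[n --> \oo] --> L%:R * flux_formula L N M p.
Proof.
move=> [NL M0 MN] p01 /(has_counts_lift NL)[K [z [n [xzn sumN LE hM]]]].
have nN i : (n i < N.+1)%N by rewrite ltnS -sumN (bigD1 i) //= leq_addr.
pose s : {ffun 'I_K -> 'I_N.+1} := [ffun i => Ordinal (nN i)].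
have sE i : s i = n i :> nat by rewrite ffunE.
pose heavy : pred 'I_K := fun i => (1 < n i)%N.
have sD : s \in zrp_states N heavy.
  apply/zrp_statesP; split; first by move=> i; rewrite sE.
  by rewrite -[RHS]sumN; apply: eq_bigr => i _; rewrite sE.
have xzs : lifts x z (fun i => s i : nat).
  case: xzn => h1 h2 h3; split.
  - by move=> i; rewrite sE.
  - by move=> i t; rewrite sE; exact: h2.
  by rewrite -[RHS]h3; apply: eq_bigr => i _; rewrite sE.
under eq_fun => k do rewrite (transfer_lift p k sD xzs).
rewrite -hM [in L%:R]LE [in flux_formula L]LE.
by apply: zrp_transfer_cvg; rewrite ?hM //; lia.
Qed.

End FluxLimit.

(** * The integer update equation and its Boolean solution *)

Lemma q_ruleE b w x y z : q_rule b w x y z = [&& y, ~~ z & ~~ x || (w && b)].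
Proof. by case: w; case: x; case: y; case: z. Qed.

Lemma v_step_balance (L : nat) (x c : config L) j :
  (v_step x c j + local_flux q_rule c x j =
   x j + local_flux q_rule c x (ord_pred j))%N.
Proof.
rewrite ffunE /local_flux !q_ruleE ord_predK.
move: (~~ x _ || _) (~~ x _ || _) => A B.
by case: (x j); case: (x (ord_pred j)); case: (x (ordS j)); case: A; case: B.
Qed.

Lemma v_step_ones (L : nat) (x c : config L) : (\sum_j v_step x c j = \sum_j x j)%N.
Proof.
apply: (@addIn (\sum_j local_flux q_rule c x j)%N).
rewrite -big_split /= (eq_bigr _ (fun j _ => v_step_balance x c j)) big_split /=.
congr (_ + _)%N; rewrite [RHS](reindex_inj (@ord_pred_inj L)) /=.
by [].
Qed.

Lemma v_step_unique (L : nat) (x c y : config L) :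
  (forall j, (y j)%:Z = (x j)%:Z + (local_flux q_rule c x (ord_pred j))%:Z
      - (local_flux q_rule c x j)%:Z) ->
  y = v_step x c.
Proof.
move=> yE; apply/ffunP => j; have := v_step_balance x c j; have := yE j.
move: (local_flux _ _ _ _) (local_flux _ _ _ _) => q q'.
by case: (y j); case: (v_step x c j); case: (x j); case: q; case: q'; lia.
Qed.

(** * Path probabilities and the Markov property of the v-process *)

Section Process.
Local Open Scope classical_set_scope.
Context {d : measure_display} {T : measurableType d} {R : realType}.
Variable P : probability T R.

Lemma discrete_rv_fin (S : finType) (X : T -> S) :
  (forall x, measurable (X @^-1` [set x])) -> discrete_rv X.
Proof.
move=> mX _ [B _ <-].
rewrite (_ : X @^-1` B = \bigcup_(x in B) X @^-1` [set x]).
  by apply: fin_bigcup_measurable => [|x _ //]; exact: finite_finset.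
by apply/seteqP; split => [w Bw|w [x Bx /= ->] //]; exists (X w).
Qed.

Lemma discrete_rv_preimage (S : Type) (X : T -> S) (B : set S) :
  discrete_rv X -> measurable (X @^-1` B).
Proof. by apply; exists B. Qed.

Lemma probability_split (S : finType) (X : T -> S) (A : set T) :
  discrete_rv X -> measurable A ->
  fine (P A) = \sum_x fine (P (A `&` X @^-1` [set x])).
Proof.
move=> mX mA.
have mAX x : measurable (A `&` X @^-1` [set x]).
  by apply: measurableI => //; exact: discrete_rv_preimage.
rewrite [in LHS](_ : A = \bigcup_(x in [set: S]) (A `&` X @^-1` [set x])); last first.
  by apply/seteqP; split => [w Aw|w [x _ []] //]; exists (X w).
rewrite measure_fin_bigcup //; last first.
- by move=> x y _ _ [w [[_ /= <-] [_ /= <-]]].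
- exact: finite_finset.
rewrite (_ : [set: S] = [set` index_enum S]); last first.
  by apply/seteqP; split => // x _ /=; rewrite mem_index_enum.
rewrite -fsbig_seq ?index_enum_uniq // sum_fine // => x _; exact: fin_num_measure.
Qed.

Variables (L : nat) (p : R) (b : nat -> 'I_L -> T -> bool) (v : nat -> T -> config L).
Hypothesis bv : v_system P p b v.

Definition noise (n : nat) (w : T) : config L := [ffun j => b n j w].

Definition cylinder (x : config L) (cs : seq (config L)) : set T :=
  [set w | v 0%N w = x /\ mkseq (noise^~ w) (size cs) = cs].

Lemma v_stepP n w : v n.+1 w = v_step (v n w) (noise n w).
Proof.
apply: v_step_unique => j; have [_ /(_ n w j) /= ->] := bv.
by rewrite /local_flux !ffunE.
Qed.

Lemma cylinder_rcons x cs c :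
  cylinder x (rcons cs c) = cylinder x cs `&` noise (size cs) @^-1` [set c].
Proof.
apply/seteqP; split => w; rewrite /cylinder /= size_rcons mkseqS.
  by move=> [-> /rcons_inj[-> ->]].
by move=> [[-> ->] ->].
Qed.

Lemma cylinder_v x cs w : cylinder x cs w -> v (size cs) w = foldl (@v_step L) x cs.
Proof.
elim/last_ind: cs => [|cs c IHcs]; first by case.
by rewrite cylinder_rcons => -[/IHcs e /= <-]; rewrite size_rcons v_stepP e foldl_rcons.
Qed.

Lemma discrete_noise n : discrete_rv (noise n).
Proof.
have [[_ db _ _] _] := bv; apply: discrete_rv_fin => c.
rewrite (_ : _ @^-1` _ = \bigcap_(j in [set: 'I_L]) (b n j @^-1` [set c j])).
  apply: fin_bigcap_measurable => [|j _]; first exact: finite_finset.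
  by apply: discrete_rv_preimage.
apply/seteqP; split => w /=; first by move=> <- j _; rewrite ffunE.
by move=> h; apply/ffunP => j; rewrite ffunE h.
Qed.

Lemma measurable_cylinder x cs : measurable (cylinder x cs).
Proof.
elim/last_ind: cs => [|cs c IHcs].
  have [[dv _ _ _] _] := bv.
  rewrite (_ : cylinder x [::] = v 0%N @^-1` [set x]); first exact: discrete_rv_preimage.
  by apply/seteqP; split => w /=; rewrite /cylinder /=; [case | ].
rewrite cylinder_rcons; apply: measurableI => //.
by apply: discrete_rv_preimage; exact: discrete_noise.
Qed.

Lemma discrete_v n : discrete_rv (v n).
Proof.
have [[dv _ _ _] _] := bv; elim: n => // n IHn; apply: discrete_rv_fin => y.
rewrite (_ : _ @^-1` _ = \bigcup_(x in [set: config L])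
   (v n @^-1` [set x] `&` noise n @^-1` [set c | v_step x c = y])).
  apply: fin_bigcup_measurable => [|x _]; first exact: finite_finset.
  by apply: measurableI; apply: discrete_rv_preimage => //; exact: discrete_noise.
apply/seteqP; split => w /=; first by rewrite v_stepP => e; exists (v n w).
by move=> [x _ [<-]]; rewrite v_stepP.
Qed.

Lemma probability_bit n j a : P (b n j @^-1` [set a]) = (bern p a)%:E.
Proof.
have [[_ db Pb _] _] := bv; case: a; first by rewrite -(Pb n j).
rewrite (_ : _ @^-1` _ = ~` [set w | b n j w]).
  rewrite probability_setC ?Pb //.
  exact: (@discrete_rv_preimage _ _ [set a : bool | a] (db n j)).
by apply/seteqP; split => w /=; [move=> -> | move/negP/negbTE].
Qed.

(** A cylinder is a finite intersection of one event per index, [None] for the initial configuration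
    and one index for each bit up to the length of [cs], so mutual independence factorizes its
    probability. *)
Lemma probability_cylinder x cs :
  fine (P (cylinder x cs)) = fine (P (v 0%N @^-1` [set x])) * \prod_(c <- cs) bits_prob p c.
Proof.
have [[dv db _ ind] _] := bv; pose k := size cs.
pose c0 : config L := [ffun=> false].
pose A (i : option (nat * 'I_L)) : set T :=
  if i is Some (n, j) then b n j @^-1` [set nth c0 cs n j] else v 0%N @^-1` [set x].
pose J := None :: map (@Some (nat * 'I_L)) [seq (n, j) | n <- iota 0 k, j <- enum 'I_L].
have cylE : cylinder x cs = \bigcap_(i in [set` J]) A i.
  apply/seteqP; split => w.
    move=> [vx nc] i /=; rewrite inE => /orP[/eqP -> //|/mapP[[n j]]].
    move=> /allpairsP[[n' j'] [/= nk _ [-> ->]]] -> /=.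
    by rewrite -[in RHS]nc nth_mkseq ?ffunE //; move: nk; rewrite mem_iota.
  move=> h; split; first exact: (h None).
  apply: (@eq_from_nth _ c0); rewrite size_mkseq // => n nk.
  rewrite nth_mkseq //; apply/ffunP => j; rewrite ffunE.
  apply: (h (Some (n, j))); rewrite /= inE; apply/orP; right.
  apply/map_f/allpairsP; exists (n, j); split => //=; first by rewrite mem_iota.
  by rewrite mem_enum.
rewrite cylE ind.
- rewrite big_cons big_map big_allpairs /=.
  rewrite (eq_bigr (fun n => (bits_prob p (nth c0 cs n))%:E)); last first.
    move=> n _; rewrite (eq_bigr (fun j => (bern p (nth c0 cs n j))%:E)).
      by rewrite prodEFin big_enum.
    by move=> j _; exact: probability_bit.
  rewrite prodEFin fineM ?fin_num_measure //=; last exact: discrete_rv_preimage.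
  congr (_ * _); rewrite [RHS](big_nth c0) -/k /index_iota subn0 //.
- rewrite /= map_inj_uniq; last exact: Some_inj.
  rewrite allpairs_uniq ?iota_uniq ?enum_uniq //; last by move=> [? ?] [? ?].
  by rewrite andbT; apply/negP => /mapP[].
- move=> [[n j]|] _ /=; first by exists [set nth c0 cs n j].
  by exists [set x].
Qed.

Definition mean_over_noise (h : config L -> config L -> bool) (y : config L) : R :=
  \sum_(c : config L) bits_prob p c * (h y c)%:R.

Lemma measurable_event (h : config L -> config L -> bool) n :
  measurable [set w | h (v n w) (noise n w)].
Proof.
rewrite (_ : mkset _ = \bigcup_(x in [set: config L])
   (v n @^-1` [set x] `&` noise n @^-1` [set c | h x c])).
  apply: fin_bigcup_measurable => [|x _]; first exact: finite_finset.
  by apply: measurableI; apply: discrete_rv_preimage; [exact: discrete_v|exact: discrete_noise].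
by apply/seteqP; split => w /=; [exists (v n w) | move=> [x _ [<-]]].
Qed.

(** Markov property: on the cylinder the current configuration is known, and the future is averaged
    by [transfer] from there. Each induction step splits over the next noise row, which lengthens
    [cs]. *)
Lemma probability_cylinder_event (h : config L -> config L -> bool) m x cs :
  fine (P (cylinder x cs `&` [set w | h (v (size cs + m)%N w) (noise (size cs + m)%N w)])) =
  fine (P (cylinder x cs)) *
    iter m (transfer (bits_prob p (I := _)) (@v_step L)) (mean_over_noise h)
      (foldl (@v_step L) x cs).
Proof.
elim: m => [|m IHm] in cs *;
  rewrite (probability_split (@discrete_noise (size cs))) /=; try
   (by apply: measurableI; [exact: measurable_cylinder | exact: measurable_event]).
  rewrite addn0 /mean_over_noise mulr_sumr; apply: eq_bigr => c _.
  rewrite mulrA (_ : fine (P (cylinder x cs)) * bits_prob p c =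
    fine (P (cylinder x (rcons cs c)))).
    case hc : (h _ c).
      rewrite mulr1 cylinder_rcons; congr (fine (P _)); apply/seteqP; split => w.
        by move=> [[]].
      by move=> [xw wc]; split=> //; split=> //=; rewrite (cylinder_v xw) wc.
    rewrite mulr0 (_ : _ `&` _ = set0) ?measure0 //; apply/seteqP; split => // w.
    by move=> [[xw /=] ] + wc; rewrite (cylinder_v xw) wc hc.
  by rewrite !probability_cylinder -cats1 big_cat big_seq1 mulrA.
rewrite /transfer mulr_sumr; apply: eq_bigr => c _.
rewrite mulrA (_ : fine (P (cylinder x cs)) * bits_prob p c =
  fine (P (cylinder x (rcons cs c)))).
  rewrite -foldl_rcons -IHm size_rcons addSnnS cylinder_rcons; congr (fine (P _)).
  by rewrite setIAC.
by rewrite !probability_cylinder -cats1 big_cat big_seq1 mulrA.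
Qed.

Lemma probability_event (h : config L -> config L -> bool) n :
  fine (P [set w | h (v n w) (noise n w)]) =
  \sum_x fine (P (v 0%N @^-1` [set x])) *
    iter n (transfer (bits_prob p (I := _)) (@v_step L)) (mean_over_noise h) x.
Proof.
have [[dv _ _ _] _] := bv.
rewrite (probability_split dv (measurable_event h n)); apply: eq_bigr => x _.
rewrite setIC; have := probability_cylinder_event h n x [::]; rewrite add0n /=.
rewrite (_ : cylinder x [::] = v 0%N @^-1` [set x]) //.
by apply/seteqP; split => w /=; rewrite /cylinder /=; [case | ].
Qed.

Lemma expectation_event (h : config L -> config L -> bool) n :
  fine ('E_P[(fun w => (h (v n w) (noise n w))%:R : R)])%E =
  fine (P [set w | h (v n w) (noise n w)]).
Proof.
rewrite -expectation_indic; last exact: measurable_event.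
congr (fine ('E_P[_])%E); apply/funext => w; rewrite indicE.
by congr ((nat_of_bool _)%:R); apply/idP/idP; rewrite inE.
Qed.

End Process.

(** * Convergence of the mean flux from an arbitrary initial distribution *)

Lemma q_rule_le (b w x y z : bool) : (q_rule b w x y z <= y)%N.
Proof. by rewrite q_ruleE; case: y => //=; case: (_ && _). Qed.

Lemma bits_prob_const (R : realType) (p : R) (I : finType) (a : R) :
  \sum_(c : {ffun I -> bool}) bits_prob p c * a = a.
Proof. by rewrite -mulr_suml bits_prob_sum1 mul1r. Qed.

Lemma sum_noise_fluxes (R : realType) (p : R) (L : nat) (x : config L) :
  \sum_j mean_over_noise p (fun y c => local_flux q_rule c y j) x = mean_flux p x.
Proof.
rewrite /mean_over_noise exchange_big /=.
by apply: eq_bigr => c _; rewrite mulr_sumr.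
Qed.

(** The ones that stay put are what the flux of the mirrored u-system counts (see [q1_ruleE]). Since
    jumps start only at occupied sites, their number is the number of ones minus the number of
    jumps. *)
Lemma sum_noise_stays (R : realType) (p : R) (L : nat) (x : config L) :
  \sum_j mean_over_noise p (fun y c => y j && ~~ local_flux q_rule c y j) x =
  (\sum_j x j)%N%:R - mean_flux p x.
Proof.
rewrite -sum_noise_fluxes natr_sum -sumrB; apply: eq_bigr => j _.
rewrite -[X in X - _](bits_prob_const p 'I_L) -sumrB.
apply: eq_bigr => c _; rewrite -mulrBr -natrB ?q_rule_le //; congr (_ * _%:R).
by have := q_rule_le (c j) (x (ord_pred (ord_pred j))) (x (ord_pred j)) (x j) (x (ordS j));
   rewrite /local_flux; case: (x j); case: (q_rule _ _ _ _ _).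
Qed.

Lemma transfer_stays (R : realType) (p : R) (L n : nat) (x : config L) :
  iter n (transfer (bits_prob p (I := _)) (@v_step L))
    (fun y : config L => (\sum_j y j)%N%:R - mean_flux p y) x =
  (\sum_j x j)%N%:R - iter n (transfer (bits_prob p (I := _)) (@v_step L)) (mean_flux p) x.
Proof.
elim: n x => //= n IHn x; rewrite /transfer.
rewrite -[X in _ = X - _](bits_prob_const p 'I_L) -sumrB.
by apply: eq_bigr => c _; rewrite IHn v_step_ones mulrBr.
Qed.

Section MeanFlux.
Local Open Scope classical_set_scope.
Context {d : measure_display} {T : measurableType d} {R : realType}.
Variables (P : probability T R) (L N M : nat) (p : R).
Variables (b : nat -> 'I_L -> T -> bool) (v : nat -> T -> config L).
Hypotheses (bv : v_system P p b v) (v0 : supported_on_counts P N M (v 0%N)).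

Lemma initial_mass : \sum_x fine (P (v 0%N @^-1` [set x])) = 1.
Proof.
have [[dv _ _ _] _] := bv.
have := probability_split P dv (measurableT : measurable [set: T]).
rewrite probability_setT /= => ->; apply: eq_bigr => x _.
by rewrite setTI.
Qed.

Lemma initial_mass_support x : ~ has_counts N M x -> fine (P (v 0%N @^-1` [set x])) = 0.
Proof.
move=> nx; have [[dv _ _ _] _] := bv.
have mH : measurable [set w | has_counts N M (v 0%N w)].
  exact: (@discrete_rv_preimage _ _ _ _ [set y | has_counts N M y] dv).
have PH : P (~` [set w | has_counts N M (v 0%N w)]) = 0%E.
  by rewrite probability_setC // v0 subee.
rewrite (subset_measure0 _ _ _ PH) //.
- exact: discrete_rv_preimage.
- exact: measurableC.
- by move=> w /= ->.
Qed.

(** The expectation is an average over initial configurations. Those with other counts have mass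
    zero and all the rest share the limit [l], so the initial distribution drops out. *)
Lemma event_rate_cvg (h : 'I_L -> config L -> config L -> bool) (l : R) :
  (forall x, has_counts N M x ->
    iter n (transfer (bits_prob p (I := _)) (@v_step L))
      (fun x => \sum_j mean_over_noise p (h j) x) x @[n --> \oo] --> l) ->
  L%:R^-1 * \sum_j fine ('E_P[(fun w => (h j (v n w) (noise b n w))%:R : R)])%E
    @[n --> \oo] --> L%:R^-1 * l.
Proof.
move=> hl; apply: cvgM; first exact: cvg_cst.
rewrite (_ : (fun n => \sum_j _) = (fun n => \sum_x fine (P (v 0%N @^-1` [set x])) *
    iter n (transfer (bits_prob p (I := _)) (@v_step L))
      (fun x => \sum_j mean_over_noise p (h j) x) x)); last first.
  apply/funext => n.
  under eq_bigr => j _ do rewrite (expectation_event bv) (probability_event bv).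
  rewrite exchange_big /=; apply: eq_bigr => x _.
  by rewrite -mulr_sumr -transfer_sum.
rewrite -[l]mul1r -initial_mass mulr_suml.
apply: cvg_big => [|x _]; first exact: add_continuous.
have [/hl cx|/initial_mass_support ->] := pselect (has_counts N M x).
  by apply: cvgM => //; exact: cvg_cst.
by rewrite mul0r; under eq_fun do rewrite mul0r; exact: cvg_cst.
Qed.

Lemma v_mean_flux : admissible L N M -> 0 < p < 1 ->
  has_mean_flux P q_rule b v (flux_formula L N M p).
Proof.
move=> adm p01; have L0 : L%:R != 0 :> R by case: adm; rewrite pnatr_eq0; lia.
have := @event_rate_cvg (fun j y c => local_flux q_rule c y j) (L%:R * flux_formula L N M p).
rewrite mulKf // => h; rewrite /has_mean_flux.
rewrite (_ : flux_at _ _ _ _ = fun n => L%:R^-1 * \sum_j fine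
  ('E_P[(fun w => (local_flux q_rule (noise b n w) (v n w) j)%:R : R)])%E).
  apply: h => x xNM.
  rewrite (_ : (fun x => \sum_j _) = mean_flux p); first exact: mean_flux_cvg xNM.
  by apply/funext => y; exact: sum_noise_fluxes.
apply/funext => n; congr (_ * _); apply: eq_bigr => j _.
by congr (fine ('E_P[_])%E); apply/funext => w; rewrite /local_flux ffunE.
Qed.

Lemma v_mean_stay : admissible L N M -> 0 < p < 1 ->
  L%:R^-1 * \sum_j fine ('E_P[(fun w =>
      (v n w j && ~~ local_flux q_rule (fun k => b n k w) (v n w) j)%:R : R)])%E
    @[n --> \oo] --> N%:R / L%:R - flux_formula L N M p.
Proof.
move=> adm p01; have L0 : L%:R != 0 :> R by case: adm; rewrite pnatr_eq0; lia.
have := @event_rate_cvg (fun j y c => y j && ~~ local_flux q_rule c y j)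
  (N%:R - L%:R * flux_formula L N M p).
rewrite mulrBr mulKf // [_ * N%:R]mulrC => h.
rewrite (_ : (fun n => _) = fun n => L%:R^-1 * \sum_j fine ('E_P[(fun w =>
      (v n w j && ~~ local_flux q_rule (noise b n w) (v n w) j)%:R : R)])%E).
  apply: h => x xNM.
  rewrite (_ : (fun x => \sum_j _) =
      (fun y : config L => (\sum_j y j)%N%:R - mean_flux p y)); last first.
    by apply/funext => y; exact: sum_noise_stays.
  rewrite (_ : (fun n => _) = (fun n => (\sum_j x j)%N%:R -
      iter n (transfer (bits_prob p (I := _)) (@v_step L)) (mean_flux p) x)).
    apply: cvgB; last exact: mean_flux_cvg xNM.
    by rewrite -word_count1; case: xNM => -> _; exact: cvg_cst.
  by apply/funext => n; exact: transfer_stays.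
apply/funext => n; congr (_ * _); apply: eq_bigr => j _.
by congr (fine ('E_P[_])%E); apply/funext => w; rewrite /local_flux ffunE.
Qed.

End MeanFlux.

(** * The u-system as a mirror image of the v-system *)

(* The site n - j of u^n corresponding to the site j of v^n, up to a fixed
   rotation of the cycle. *)
Definition mirror (L n : nat) (j : 'I_L) : 'I_L := iter n (@ordS L) (rev_ord j).

Lemma ordS_pred_comm (L : nat) (j : 'I_L) : ordS (ord_pred j) = ord_pred (ordS j).
Proof. by rewrite ordSK ord_predK. Qed.

Lemma rev_ordS (L : nat) (j : 'I_L) : rev_ord (ordS j) = ord_pred (rev_ord j).
Proof.
apply/val_inj; rewrite /=; have := ltn_ord j; move: (nat_of_ord j) => k kL.
have [kL'|kL'] := ltnP k.+1 L.
  rewrite modn_small // (_ : (L - k.+1 + L).-1 = (L - k.+2) + L)%N; last by lia.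
  by rewrite modnDr modn_small //; lia.
have -> : k.+1 = L by lia.
by rewrite modnn subnn add0n modn_small ?subn1 //; lia.
Qed.

Lemma mirrorS (L n : nat) (j : 'I_L) : mirror n (ordS j) = ord_pred (mirror n j).
Proof.
rewrite /mirror rev_ordS; elim: n => //= n ->.
by rewrite ordS_pred_comm.
Qed.

Lemma mirror_pred (L n : nat) (j : 'I_L) : mirror n (ord_pred j) = ordS (mirror n j).
Proof. by rewrite -{2}(ord_predK j) mirrorS ord_predK. Qed.

Lemma mirror_inj (L n : nat) : injective (@mirror L n).
Proof.
rewrite /mirror; elim: n => [|n IHn] i j /=; first exact: rev_ord_inj.
by move=> /ordS_inj/IHn.
Qed.

Lemma q1_ruleE a w x y z : q1_rule a w x y z = x && ~~ q_rule (~~ a) z y x w.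
Proof. by case: a; case: w; case: x; case: y; case: z. Qed.

Lemma word_count110 (L : nat) (x : config L) :
  word_count [:: true; true; false] x =
  (\sum_j [&& x j, x (ordS j) & ~~ x (ordS (ordS j))])%N.
Proof.
rewrite /word_count -sum1_card big_mkcond /=; apply: eq_bigr => j _.
rewrite inE /word_at /= !eqseq_cons andbT !eqb_id eqbF_neg.
by case: [&& _, _ & _].
Qed.

(* Runs of length at least two have as many left ends as right ends. *)
Lemma sum_011_110 (L : nat) (x : config L) :
  (\sum_j [&& ~~ x j, x (ordS j) & x (ordS (ordS j))] =
   \sum_j [&& x j, x (ordS j) & ~~ x (ordS (ordS j))])%N.
Proof.
apply: (@addIn (\sum_j [&& x j, x (ordS j) & x (ordS (ordS j))])%N).
transitivity (\sum_j (x j && x (ordS j)))%N.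
  rewrite [RHS](reindex_inj (@ordS_inj L)) -big_split /=; apply: eq_bigr => j _.
  by case: (x j); case: (x (ordS j)); case: (x _).
rewrite -big_split /=; apply: eq_bigr => j _.
by case: (x j); case: (x (ordS j)); case: (x _).
Qed.

(** Reflection turns occurrences of 110 into occurrences of 011, which are equally numerous by
    [sum_011_110]. *)
Lemma has_counts_mirror (L N M n : nat) (x : config L) :
  has_counts N M x <-> has_counts N M [ffun j => x (mirror n j)].
Proof.
rewrite /has_counts !word_count1 !word_count110.
have -> : (\sum_j [ffun j => x (mirror n j)] j = \sum_j x j)%N.
  rewrite [RHS](reindex_inj (@mirror_inj L n)) /=.
  by apply: eq_bigr => j _; rewrite ffunE.
suff -> : (\sum_j [&& [ffun j => x (mirror n j)] j, [ffun j => x (mirror n j)] (ordS j)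
    & ~~ [ffun j => x (mirror n j)] (ordS (ordS j))] =
  \sum_j [&& x j, x (ordS j) & ~~ x (ordS (ordS j))])%N by [].
rewrite -sum_011_110 (reindex_inj (@ord_pred_inj L)) (reindex_inj (@ord_pred_inj L)).
rewrite [RHS](reindex_inj (@mirror_inj L n)) /=.
apply: eq_bigr => j _; rewrite !ffunE !ord_predK !mirror_pred.
by case: (x _); case: (x _); case: (x _).
Qed.

Section Mirror.
Local Open Scope classical_set_scope.
Context {d : measure_display} {T : measurableType d} {R : realType}.
Variables (P : probability T R) (L : nat) (p : R).
Variables (a : nat -> 'I_L -> T -> bool) (u : nat -> T -> config L).
Hypothesis au : u_system P p a u.

Definition mirror_config n w : config L := [ffun j => u n w (mirror n j)].
(** In the [q1_rule] window attached to k the entry playing the role of the mirrored centre sits at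
    k - 1, so the bit is taken at the successor of [mirror n j]; the negation is b = 1 - a. *)
Definition mirror_bit n j w : bool := ~~ a n (ordS (mirror n j)) w.

Lemma mirror_flux n w j :
  local_flux q1_rule (fun k => a n k w) (u n w) (ordS (mirror n j)) =
  mirror_config n w j &&
    ~~ local_flux q_rule (fun k => mirror_bit n k w) (mirror_config n w) j.
Proof.
by rewrite /local_flux q1_ruleE /mirror_bit !ffunE !mirrorS !mirror_pred ordSK.
Qed.

Lemma mutually_independent_reindex (I I' : choiceType) (F : I -> set (set T))
    (phi : I' -> I) (psi : I -> I') : cancel phi psi ->
  mutually_independent P F ->
  mutually_independent P (fun i => F (phi i)).
Proof.
move=> phiK ind J A uJ FA.
have := ind (map phi J) (fun i => A (psi i)).
rewrite big_map (map_inj_uniq (can_inj phiK)) => /(_ uJ).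
rewrite (eq_bigr (fun i => P (A i))) => [|i _]; last by rewrite phiK.
move=> <-.
  congr (P _); apply/seteqP; split => w h i /=.
    by move=> /mapP[k kJ ->]; rewrite phiK; exact: h.
  by move=> iJ; have := h (phi i) (map_f phi iJ); rewrite phiK.
by move=> _ /mapP[k kJ ->]; rewrite phiK; exact: FA.
Qed.

Lemma mirror_system : v_system P p mirror_bit mirror_config.
Proof.
have [[du da Pa ind] uE] := au; split; last first.
  move=> n w j; cbv zeta; rewrite [mirror_config n.+1 w j]ffunE uE; cbv zeta.
  (* The moving frame shifts by one site per time step, so the old value is V (j - 1). Its outflow
     term leaves q (j - 1) of it, and the inflow is V j - q j, which together make the v-update. *)
  rewrite (_ : mirror n.+1 j = ordS (mirror n j)) // mirror_flux -mirror_pred mirror_flux.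
  set V := mirror_config n w; set q := local_flux q_rule _ V.
  rewrite (_ : u n w (mirror n (ord_pred j)) = V (ord_pred j)); last by rewrite ffunE.
  have qV i : (q i <= V i)%N by exact: q_rule_le.
  have := qV j; have := qV (ord_pred j).
  by case: (q j); case: (q (ord_pred j)); case: (V j); case: (V (ord_pred j)).
split.
- move=> _ [B _ <-].
  rewrite (_ : _ @^-1` B = u 0%N @^-1` [set x | B [ffun j => x (mirror 0 j)]]) //.
  exact: discrete_rv_preimage.
- move=> n j _ [B _ <-].
  rewrite (_ : _ @^-1` B = a n (ordS (mirror n j)) @^-1` [set x | B (~~ x)]) //.
  exact: discrete_rv_preimage.
- move=> n j; rewrite (_ : mkset _ = ~` [set w | a n (ordS (mirror n j)) w]).
    rewrite probability_setC ?Pa; first by rewrite -EFinB subKr.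
    exact: (@discrete_rv_preimage _ _ _ _ [set x : bool | x] (da _ _)).
  by apply/seteqP; split => w /=; rewrite /mirror_bit => /negP.
pose phi (i : option (nat * 'I_L)) : option (nat * 'I_L) :=
  if i is Some (n, j) then Some (n, ordS (mirror n j)) else None.
pose psi (i : option (nat * 'I_L)) : option (nat * 'I_L) :=
  if i is Some (n, j) then Some (n, invF (@mirror_inj L n) (ord_pred j)) else None.
have phiK : cancel phi psi.
  by move=> [[n j]|] //=; rewrite ordSK invF_f.
move=> J A uJ FA; apply: (mutually_independent_reindex phiK ind uJ) => -[[n j]|] iJ /=.
  have [B _ <-] := FA _ iJ; exists [set x | B (~~ x)] => //.
have [B _ <-] := FA _ iJ; exists [set x | B [ffun j => x (mirror 0 j)]] => //.
Qed.

Lemma u_mean_flux N M : supported_on_counts P N M (u 0%N) ->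
  admissible L N M -> 0 < p < 1 ->
  has_mean_flux P q1_rule a u (N%:R / L%:R - flux_formula L N M p).
Proof.
move=> u0 adm p01.
have v0 : supported_on_counts P N M (mirror_config 0).
  rewrite /supported_on_counts -[RHS]u0; congr (P _).
  by apply/seteqP; split => w; rewrite /= (has_counts_mirror N M 0 (u 0%N w)).
have := v_mean_stay mirror_system v0 adm p01; rewrite /has_mean_flux.
rewrite (_ : flux_at _ _ _ _ = fun n => L%:R^-1 * \sum_j fine ('E_P[(fun w =>
   (mirror_config n w j && ~~ local_flux q_rule (fun k => mirror_bit n k w)
      (mirror_config n w) j)%:R : R)])%E) //.
apply/funext => n; rewrite /flux_at; congr (_ * _).
rewrite (reindex_inj (inj_comp (@ordS_inj L) (@mirror_inj L n))) /=.
apply: eq_bigr => j _; congr (fine ('E_P[_])%E); apply/funext => w.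
by rewrite mirror_flux.
Qed.

End Mirror.

(** * The limit alpha -> 1 and the theorem *)

Lemma heavy_le (L N M : nat) (x : config L) :
  (N < L)%N -> has_counts N M x -> (M <= L - N)%N.
Proof.
move=> NL /(has_counts_lift NL)[K [z [n [_ _ -> <-]]]].
by rewrite addnK -[leqRHS]card_ord max_card.
Qed.

(* The largest value of k1 + k2 carrying a positive weight. *)
Definition max_level (L N M : nat) : nat := minn (L - N) (N - 2 * M).

(** The binomials force k2 <= L - N - M and k1 <= M, and the compositions force k1 <= N - 2M -
    k2. *)
Lemma weight_count_level (L N M k1 k2 : nat) : (N < L)%N -> (M <= L - N)%N ->
  weight_count L N M k1 k2 != 0%N -> (k1 + k2 <= max_level L N M)%N.
Proof.
move=> NL ML; rewrite (_ : L = (L - N - M) + M + N)%N; last by lia.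
rewrite weight_countE /max_level; set r := (L - N - M)%N.
rewrite !muln_eq0 !negb_or -!lt0n !bin_gt0 => /andP[/andP[k2r k1M]].
case: ifP => // k2N; case: (leqP k1 (N - (k2 + 2 * M))) => [? _|]; first by lia.
by move=> /compositions_gt ->.
Qed.

Lemma weight_count_max_level (L N M : nat) : admissible L N M -> (M <= L - N)%N ->
  exists k1 k2, [/\ (k1 + k2 = max_level L N M)%N, (k1 <= N)%N, (k2 <= N)%N
    & weight_count L N M k1 k2 != 0%N].
Proof.
(* Take k2 as large as possible and fill up with k1. Either k2 = N - 2M and k1 = 0, or N - 2M - k2 >
   0 and k1 >= 1 because M > 0; both are nonzero cases of [weight_count]. *)
move=> [NL M0 MN] ML; pose k2 := minn (L - N - M) (N - 2 * M).
exists (max_level L N M - k2)%N, k2; rewrite /max_level.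
split; try by rewrite /k2; lia.
rewrite (_ : L = (L - N - M) + M + N)%N; last by lia.
rewrite weight_countE !muln_eq0 !negb_or -!lt0n !bin_gt0.
rewrite ifT; last by rewrite /k2; lia.
apply/andP; split; first by rewrite /k2; lia.
by apply: compositions_gt0; rewrite /k2; lia.
Qed.

Section LimitOne.
Local Open Scope classical_set_scope.
Variable R : realType.

(** Multiplying numerator and denominator by (1 - alpha)^K, with K the maximal level, turns both
    into polynomials in alpha. At alpha = 1 only the terms with k1 + k2 = K survive, and there alpha
    k1 + k2 equals K. *)
Lemma flux_formula_cvg1 (L N M : nat) : admissible L N M -> (M <= L - N)%N ->
  flux_formula L N M alpha @[alpha --> (1 : R)^'-] --> ((max_level L N M)%:R / L%:R : R).
Proof.
move=> adm ML; have NL : (N < L)%N by case: adm.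
set K := max_level L N M.
pose W (k1 k2 : nat) (x : R) : R :=
  x ^+ k2 * (1 - x) ^+ (K - (k1 + k2)) * (weight_count L N M k1 k2)%:R.
pose num (x : R) : R :=
  \sum_(0 <= k1 < N.+1) \sum_(0 <= k2 < N.+1) (x * k1%:R + k2%:R) * W k1 k2 x.
pose den (x : R) : R := \sum_(0 <= k1 < N.+1) \sum_(0 <= k2 < N.+1) W k1 k2 x.
have W_scale k1 k2 x : x < 1 ->
    x ^+ k2 / (1 - x) ^+ (k1 + k2) * (weight_count L N M k1 k2)%:R =
    (1 - x) ^- K * W k1 k2 x.
  move=> x1; have x0 : 1 - x != 0 by lra.
  rewrite /W; have [->|/(weight_count_level NL ML)] := eqVneq (weight_count L N M k1 k2) 0%N.
    by rewrite !mulr0.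
  rewrite -/K => kK.
  have : (1 - x) ^+ K = (1 - x) ^+ (K - (k1 + k2)) * (1 - x) ^+ (k1 + k2).
    by rewrite -exprD subnK.
  have : (1 - x) ^+ (K - (k1 + k2)) != 0 by rewrite expf_neq0.
  have : (1 - x) ^+ (k1 + k2) != 0 by rewrite expf_neq0.
  move: (_ ^+ (K - _)) (_ ^+ (k1 + k2)) (x ^+ k2) => A B C A0 B0 ->.
  by field; apply/andP.
have fE x : 0 < x < 1 -> L%:R^-1 * (num x / den x) = flux_formula L N M x.
  move=> /andP[x0 x1].
  have K0 : (1 - x) ^- K != 0 by rewrite invr_eq0 expf_neq0 //; lra.
  rewrite /flux_formula; congr (_ * _).
  rewrite (_ : num x / den x = ((1 - x) ^- K * num x) / ((1 - x) ^- K * den x)); last first.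
    by rewrite invfM mulrACA mulfV // mul1r.
  congr (_ / _); rewrite /num /den mulr_sumr; apply: eq_bigr => k1 _; rewrite mulr_sumr;
    apply: eq_bigr => k2 _; rewrite W_scale //; ring.
have W_cvg k1 k2 : W k1 k2 x @[x --> (1 : R)^'-] --> W k1 k2 1.
  apply: cvg_at_left_filter; apply: cvgM; last exact: cvg_cst.
  apply: cvgM; first exact: exprn_continuous.
  have h1 : 1 - x @[x --> (1 : R)] --> (1 - 1 : R).
    by apply: cvgB; [exact: cvg_cst | exact: cvg_id].
  exact: (cvg_comp _ _ h1 (@exprn_continuous R (K - (k1 + k2)) (1 - 1))).
have num_cvg : num x @[x --> (1 : R)^'-] --> num 1.
  apply: cvg_big => [|k1 _]; first exact: add_continuous.
  apply: cvg_big => [|k2 _]; first exact: add_continuous.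
  apply: cvgM => //; apply: cvgD; last exact: cvg_cst.
  apply: cvgM; last exact: cvg_cst.
  by apply: cvg_at_left_filter; exact: cvg_id.
have den_cvg : den x @[x --> (1 : R)^'-] --> den 1.
  apply: cvg_big => [|k1 _]; first exact: add_continuous.
  by apply: cvg_big => [|k2 _]; first exact: add_continuous.
have W1 k1 k2 : W k1 k2 1 = ((k1 + k2 == K) * weight_count L N M k1 k2)%N%:R.
  rewrite /W subrr expr1n mul1r expr0n natrM.
  have [->|/(weight_count_level NL ML)] := eqVneq (weight_count L N M k1 k2) 0%N.
    by rewrite !mulr0.
  rewrite -/K => kK; congr ((nat_of_bool _)%:R * _); apply/idP/eqP; lia.
have den1_gt0 : 0 < den 1.
  have [k1 [k2 [kK k1N k2N wN0]]] := weight_count_max_level adm ML.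
  rewrite /den; under eq_bigr do under eq_bigr do rewrite W1.
  under eq_bigr do rewrite -natr_sum.
  rewrite -natr_sum ltr0n lt0n !big_mkord sum_nat_eq0 negb_forall.
  apply/existsP; exists (inord k1); rewrite /= inordK // big_mkord sum_nat_eq0 negb_forall.
  apply/existsP; exists (inord k2); rewrite /= inordK // kK eqxx mul1n.
  exact: wN0.
have num1 : num 1 = K%:R * den 1.
  rewrite /num /den mulr_sumr; apply: eq_bigr => k1 _; rewrite mulr_sumr.
  apply: eq_bigr => k2 _; rewrite W1; case: eqP => [<-|]; last by rewrite !mulr0.
  by rewrite mul1r natrD.
rewrite -[K%:R](mulfK (lt0r_neq0 den1_gt0)) -num1 [_ / L%:R]mulrC.
have h : L%:R^-1 * (num x / den x) @[x --> (1 : R)^'-] --> L%:R^-1 * (num 1 / den 1).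
  apply: cvgM; first exact: cvg_cst.
  by apply: cvgM => //; apply: cvgV => //; rewrite gt_eqF.
apply: cvg_trans h; apply: near_eq_cvg; near=> x; apply: fE.
by apply/andP; split; near: x; [exact: nbhs_left_gt | exact: nbhs_left_lt].
Unshelve. all: by end_near. Qed.

End LimitOne.

Local Open Scope classical_set_scope.

Theorem corollary4p3 (R : realType) (L : nat) :
  (* mean flux of (v^n) *)
  (forall (N M : nat) (alpha : R), admissible L N M -> 0 < alpha < 1 ->
     forall (d : measure_display) (T : measurableType d) (P : probability T R)
       (b : nat -> 'I_L -> T -> bool) (v : nat -> T -> config L),
       v_system P alpha b v -> supported_on_counts P N M (v 0%N) ->
       has_mean_flux P q_rule b v (flux_formula L N M alpha))
  /\
  (* Q_u = rho_1 - Q *)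
  (forall (N M : nat) (alpha : R), admissible L N M -> 0 < alpha < 1 ->
     forall (d : measure_display) (T : measurableType d) (P : probability T R)
       (a : nat -> 'I_L -> T -> bool) (u : nat -> T -> config L),
       u_system P alpha a u -> supported_on_counts P N M (u 0%N) ->
       has_mean_flux P q1_rule a u (N%:R / L%:R - flux_formula L N M alpha))
  /\
  (* for given L and alpha, Q_u is a function of (rho_1, rho_110) *)
  (forall alpha : R, 0 < alpha < 1 ->
     exists G : R -> R -> R, forall N M : nat, admissible L N M ->
       forall (d : measure_display) (T : measurableType d) (P : probability T R)
         (a : nat -> 'I_L -> T -> bool) (u : nat -> T -> config L),
         u_system P alpha a u -> supported_on_counts P N M (u 0%N) ->
         has_mean_flux P q1_rule a u (G (N%:R / L%:R) (M%:R / L%:R)))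
  /\
  (* Q_u as a function of alpha, with L, N, M fixed *)
  (forall (N M : nat) (Qu : R -> R), admissible L N M ->
     (forall alpha : R, 0 < alpha < 1 ->
        exists (d : measure_display) (T : measurableType d)
          (P : probability T R)
          (a : nat -> 'I_L -> T -> bool) (u : nat -> T -> config L),
          [/\ u_system P alpha a u, supported_on_counts P N M (u 0%N)
            & has_mean_flux P q1_rule a u (Qu alpha)]) ->
     Qu alpha @[alpha --> 1^'-] -->
       (Num.max (2 * (N%:R / L%:R) - 1) (2 * (M%:R / L%:R)) : R)).
Proof.
have uQ N M alpha : admissible L N M -> 0 < alpha < 1 ->
    forall (d : measure_display) (T : measurableType d) (P : probability T R)
      (a : nat -> 'I_L -> T -> bool) (u : nat -> T -> config L),
    u_system P alpha a u -> supported_on_counts P N M (u 0%N) ->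
    has_mean_flux P q1_rule a u (N%:R / L%:R - flux_formula L N M alpha).
  by move=> adm a01 d T P a u au u0; exact: (u_mean_flux au u0).
split; first by move=> N M alpha adm a01 d T P b v bv v0; exact: (v_mean_flux bv v0).
split; first exact: uQ.
split.
  move=> alpha a01.
  (* L is fixed, so N and M are recovered exactly from the densities by multiplying by L. *)
  exists (fun r1 r2 => r1 -
    flux_formula L (Num.truncn (r1 * L%:R)) (Num.truncn (r2 * L%:R)) alpha).
  move=> N M adm d T P a u au u0.
  have L0 : L%:R != 0 :> R by case: adm; rewrite pnatr_eq0; lia.
  by rewrite !divfK // !natrK; exact: uQ.
move=> N M Qu adm ex; have [NL M0 MN] := adm.
have L0 : 0 < L%:R :> R by rewrite ltr0n; lia.
have QuE alpha : 0 < alpha < 1 -> Qu alpha = N%:R / L%:R - flux_formula L N M alpha.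
  move=> a01; have [d [T [P [a [u [au u0 Q]]]]]] := ex _ a01.
  exact: (cvg_unique _ Q (uQ _ _ _ adm a01 _ _ _ _ _ au u0)).
(* [admissible] does not contain this bound. It follows from the existence of a configuration with
   these counts, which is extracted from the process given at alpha = 1/2: an event of probability
   one is nonempty. *)
have ML : (M <= L - N)%N.
  have h01 : 0 < (2^-1 : R) < 1 by lra.
  have [d [T [P [a [u [_ u0 _]]]]]] := ex _ h01.
  have [[w xw]|no] := pselect (exists w, has_counts N M (u 0%N w)).
    exact: heavy_le NL xw.
  move: u0; rewrite /supported_on_counts (_ : mkset _ = set0) ?measure0; last first.
    by apply/seteqP; split => // w xw; apply: no; exists w.
  by move=> /eqP; rewrite eqe eq_sym oner_eq0.
have -> : Num.max (2 * (N%:R / L%:R) - 1) (2 * (M%:R / L%:R)) =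
    N%:R / L%:R - (max_level L N M)%:R / L%:R :> R.
  rewrite -mulrBl -natrB; last by rewrite /max_level; lia.
  rewrite (_ : N - max_level L N M = maxn (N + N - L) (2 * M))%N; last first.
    by rewrite /max_level; lia.
  have -> : 2 * (N%:R / L%:R) - 1 = ((N + N)%N%:R - L%:R) / L%:R :> R.
    by rewrite natrD; field; rewrite gt_eqF.
  have -> : 2 * (M%:R / L%:R) = (2 * M)%N%:R / L%:R :> R by rewrite natrM mulrA.
  rewrite -maxr_pMl ?invr_ge0 1?ltW //; congr (_ / _).
  (* For 2N < L the natural subtraction gives 0 while the real one is negative; both maxima then
     equal 2M. *)
  have [le_L|lt_L] := leqP L (N + N).
    by rewrite -natrB // -natr_max.
  rewrite (_ : maxn _ _ = 2 * M)%N; last by lia.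
  apply/max_idPr; apply: (le_trans (y := 0)); last exact: ler0n.
  by rewrite subr_le0 ler_nat ltnW.
apply: (@cvg_trans _ ((fun x => N%:R / L%:R - flux_formula L N M x) x @[x --> (1 : R)^'-])).
  apply: near_eq_cvg; near=> x; apply/esym/QuE.
  by apply/andP; split; near: x; [exact: nbhs_left_gt | exact: nbhs_left_lt].
by apply: cvgB; [exact: cvg_cst | exact: flux_formula_cvg1].
Unshelve. all: by end_near. Qed.
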